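(* Let $R=R^\top>0$ in $\mathbb{R}^{m\times m}$ and $Q^0=(Q^0)^\top>0$ in $\mathbb{R}^{n\times n}$, and let $(P^i)_{i\ge0}$, $(K^{i+1})_{i\ge0}$, $(Q^i)_{i\ge0}$ be generated by the model-based IRL iteration (described in the context). Then for every $i=0,1,2,\dots$, the matrix $K^{i+1}=-(R+D^\top P^iD)^{-1}(B^\top P^i+D^\top P^iC)$ is a stabilizer of the learner system $dX(s)=[AX(s)+Bu(s)]\,ds+[CX(s)+Du(s)]\,dW(s)$, $X(t)=x$.
   Context: $A,C\in\mathbb{R}^{n\times n}$ and $B,D\in\mathbb{R}^{n\times m}$ are constant matrices, and $W$ is a one-dimensional standard Brownian motion. A matrix $K\in\mathbb{R}^{m\times n}$ is called a stabilizer of the system $dX(s)=[AX(s)+Bu(s)]\,ds+[CX(s)+Du(s)]\,dW(s)$ if, for every initial value $x\in\mathbb{R}^n$ at time $t$, the solution of $dX(s)=(A+BK)X(s)\,ds+(C+DK)X(s)\,dW(s)$, $X(t)=x$, satisfies $\lim_{s\to\infty}\mathbb{E}[X(s)^\top X(s)]=0$. It is assumed that a stabilizer exists (the system is mean-square stabilizable). Target (expert) data: $Q_T=Q_T^\top>0$ in $\mathbb{R}^{n\times n}$ and $R_T=R_T^\top>0$ in $\mathbb{R}^{m\times m}$ are given; $P_T=P_T^\top>0$ is the unique positive definite solution of $$P_TA+A^\top P_T+C^\top P_TC+Q_T-[P_TB+C^\top P_TD][R_T+D^\top P_TD]^{-1}[B^\top P_T+D^\top P_TC]=0,$$ and the target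 gain matrix is $K_T=-(R_T+D^\top P_TD)^{-1}(B^\top P_T+D^\top P_TC)$, which is a stabilizer. Model-based IRL iteration: given $R>0$ and $Q^0>0$, for $i=0,1,2,\dots$: (1) $P^i$ is the symmetric solution of $P^i(A+BK_T)+(A+BK_T)^\top P^i+(C+DK_T)^\top P^i(C+DK_T)=-Q^i-K_T^\top RK_T$; (2) $K^{i+1}=-(R+D^\top P^iD)^{-1}(B^\top P^i+D^\top P^iC)$; (3) $Q^{i+1}=-A^\top P^i-P^iA-C^\top P^iC+(K^{i+1})^\top(R+D^\top P^iD)K^{i+1}$. *)

(* Defs.v *)
From HB Require Import structures.
From mathcomp Require Import all_boot all_order all_algebra.
From mathcomp Require Import all_classical all_reals all_analysis.

Set Implicit Arguments.
Unset Strict Implicit.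
Unset Printing Implicit Defensive.

Import Order.TTheory GRing.Theory Num.Theory.
Import numFieldNormedType.Exports.

Local Open Scope classical_set_scope.
Local Open Scope ring_scope.

Section BrownianMotion.
Context {d : measure_display} {Omega : measurableType d} {R : realType}.
Variables (Pr : probability Omega R) (W : R -> {RV Pr >-> R}).

Definition measurable_wrt (G : set (set Omega)) (f : Omega -> R) : Prop :=
  preimage_set_system setT f measurable `<=` G.

Definition past_events (s : R) : set (set Omega) :=
  \bigcup_(r in `[0, s]) preimage_set_system setT (W r) measurable.

Definition natural_filtration (s : R) : set (set Omega) := <<s past_events s >>.

Definition augmented_filtration (s : R) : set (set Omega) :=
  <<s past_events s `|` [set N | measurable N /\ Pr N = 0%E] >>.

Definition increment (s t : R) : Omega -> R := fun w => W t w - W s w.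

(* The Gaussian clause needs [s < t]: at standard deviation 0 the library's
   [normal_prob] is a uniform law, not a Dirac mass. *)
Definition standard_brownian_motion : Prop :=
  [/\ {ae Pr, forall w, W 0 w = 0},
      {ae Pr, forall w, {within `[0, +oo[, continuous (fun s => W s w)}},
      forall s t, 0 <= s -> s <= t ->
        forall E B, natural_filtration s E -> measurable B ->
        Pr (E `&` increment s t @^-1` B) =
          (Pr E * Pr (increment s t @^-1` B))%E
    & forall s t, 0 <= s -> s < t -> forall B : set R, measurable B ->
        Pr (increment s t @^-1` B) = normal_prob 0 (Num.sqrt (t - s)) B].

(* The process equal to [sp_val i] on [sp_time i, sp_time i.+1[, i < sp_size. *)
Record simple_process (a b : R) := SimpleProcess {
  sp_size : nat ;
  sp_time : nat -> R ;
  sp_val : nat -> Omega -> R ;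
  sp_time_start : sp_time 0%N = a ;
  sp_time_end : sp_time sp_size = b ;
  sp_time_le : forall i, (i < sp_size)%N -> sp_time i <= sp_time i.+1 ;
  sp_val_adapted : forall i, (i < sp_size)%N ->
    measurable_wrt (augmented_filtration (sp_time i)) (sp_val i) ;
  sp_val_bounded : forall i, (i < sp_size)%N ->
    exists M : R, forall w, `|sp_val i w| <= M }.

Definition sp_eval (a b : R) (phi : simple_process a b) (r : R) (w : Omega) : R :=
  \sum_(i < sp_size phi)
    sp_val phi i w * \1_(`[sp_time phi i, sp_time phi i.+1[) r.

Definition sp_integral (a b : R) (phi : simple_process a b) (w : Omega) : R :=
  \sum_(i < sp_size phi)
    sp_val phi i w * increment (sp_time phi i) (sp_time phi i.+1) w.

(* I is (a version of) the Ito integral of H dW over [a, b], in the usual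
   L^2 construction; such an I is unique up to a null set. *)
Definition is_ito_integral (H : R -> Omega -> R) (a b : R) (I : Omega -> R) : Prop :=
  exists phi : nat -> simple_process a b,
    ((\int[Pr]_w \int[lebesgue_measure]_(r in `[a, b])
        ((H r w - sp_eval (phi k) r w) ^+ 2)%:E)%E @[k --> \oo] --> 0%E) /\
    ('E_Pr[fun w => ((I w - sp_integral (phi k) w) ^+ 2)%R]%E @[k --> \oo] --> 0%E).

Definition sqr_norm n (v : 'cV[R]_n) : R := (v^T *m v) 0 0.

(* X is a (strong) solution on [t, +oo[ of dX = F X ds + G X dW, X(t) = x:
   a continuous process, adapted and square-integrable on bounded intervals,
   with X(s) - x - \int_t^s F X(r) dr = \int_t^s G X(r) dW(r) a.s. for s >= t.
   The values of X before time t are irrelevant. *)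
Definition sde_solution n (F G : 'M[R]_n) (t : R) (x : 'cV[R]_n)
    (X : R -> Omega -> 'cV[R]_n) : Prop :=
  [/\ forall w, {within `[t, +oo[, continuous (fun s => X s w)},
      forall s, t <= s -> forall j,
        measurable_wrt (augmented_filtration s) (fun w => X s w j 0),
      forall s, t <= s ->
        (\int[Pr]_w \int[lebesgue_measure]_(r in `[t, s])
           (sqr_norm (X r w))%:E < +oo)%E
    & forall s, t <= s -> forall j,
        is_ito_integral (fun r w => (G *m X r w) j 0) t s
          (fun w => X s w j 0 - x j 0 -
             \int[lebesgue_measure]_(r in `[t, s]) (F *m X r w) j 0)].

(* K stabilizes dX = (A X + B u) ds + (C X + D u) dW through u = K X. *)
Definition stabilizer n m (A : 'M[R]_n) (B : 'M[R]_(n, m))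
    (C : 'M[R]_n) (D : 'M[R]_(n, m)) (K : 'M[R]_(m, n)) : Prop :=
  forall (t : R) (x : 'cV[R]_n) (X : R -> Omega -> 'cV[R]_n), 0 <= t ->
    sde_solution (A + B *m K) (C + D *m K) t x X ->
    'E_Pr[fun w => (((X s w)^T *m X s w) 0 0)%R]%E @[s --> +oo] --> 0%E.

End BrownianMotion.

Section Matrices.
Context {R : realType} {n m : nat}.

Definition posdefmx k (M : 'M[R]_k) : Prop :=
  M^T = M /\ forall v : 'cV[R]_k, v != 0 -> 0 < (v^T *m M *m v) 0 0.

Variables (A : 'M[R]_n) (B : 'M[R]_(n, m)) (C : 'M[R]_n) (D : 'M[R]_(n, m)).

Definition gain (S : 'M[R]_m) (P : 'M[R]_n) : 'M[R]_(m, n) :=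
  - (invmx (S + D^T *m P *m D) *m (B^T *m P + D^T *m P *m C)).

Definition riccati_eq (Q : 'M[R]_n) (S : 'M[R]_m) (P : 'M[R]_n) : Prop :=
  P *m A + A^T *m P + C^T *m P *m C + Q
  - (P *m B + C^T *m P *m D) *m invmx (S + D^T *m P *m D)
      *m (B^T *m P + D^T *m P *m C) = 0.

(* (P i), (K i.+1), (Q i) are generated by model-based inverse reinforcement
   learning from the target gain KT; K 0 plays no role. *)
Definition irl_iteration (KT : 'M[R]_(m, n)) (S : 'M[R]_m) (Q0 : 'M[R]_n)
    (P : nat -> 'M[R]_n) (K : nat -> 'M[R]_(m, n)) (Q : nat -> 'M[R]_n) : Prop :=
  Q 0%N = Q0 /\
  forall i : nat,
    [/\ (P i)^T = P i,
        P i *m (A + B *m KT) + (A + B *m KT)^T *m P i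
          + (C + D *m KT)^T *m P i *m (C + D *m KT)
          = - Q i - KT^T *m S *m KT,
        K i.+1 = gain S (P i)
      & Q i.+1 = - (A^T *m P i) - P i *m A - C^T *m P i *m C
          + (K i.+1)^T *m (S + D^T *m P i *m D) *m K i.+1].

End Matrices.

(* Main.v *)
Require Import Defs.
From HB Require Import structures.
From mathcomp Require Import all_boot all_order all_algebra.
From mathcomp Require Import all_classical all_reals all_analysis.
From mathcomp Require Import measurable_realfun.
From mathcomp Require Import ring lra.

Set Implicit Arguments.
Unset Strict Implicit.
Unset Printing Implicit Defensive.

Import Order.TTheory GRing.Theory Num.Theory.
Import numFieldNormedType.Exports.
Local Open Scope classical_set_scope.
Local Open Scope ring_scope.

(* Write L_K(P) = P (A + B K) + (A + B K)^T P + (C + D K)^T P (C + D K).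
   The Riccati equation gives P_T > 0 and L_{K_T}(P_T) < 0.  If P is symmetric
   and L_{K_T}(P) < 0, then P > 0: otherwise subtract from P the multiple of
   P_T given by the (nonpositive) minimum of the Rayleigh quotient of P with
   respect to P_T and evaluate at a minimizer.  Completing the square shows
   Q^{i+1} >= Q^i > 0 and L_{K^{i+1}}(P^i) = - Q^{i+1} - (K^{i+1})^T R K^{i+1} < 0,
   so x^T P^i x is a Lyapunov function of the learner closed loop.
   For such a P, V(s) = E[X(s)^T P X(s)] satisfies V(s) = V(t) + \int_t^s E[X^T L(P) X],
   hence is nonincreasing with bounded integral, and so V(s) = O(1 / (s - t)).
   The second-moment identity is obtained from the Ito isometry without the Ito
   formula: writing X = x + A + I with A absolutely continuous and I the
   stochastic integral, E[X(r) (I(s) - I(r))] = 0 because, as a function of s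
   and of the component, it solves a homogeneous linear integral equation. *)

(** An Ito integral is given separately on each interval, as an L^2 limit of its own simple
    processes, so neither additivity in time nor the martingale property is at hand. Both are
    replaced by an isometry for two integrals over [a, b] and [a, b'] with the same left end: the
    covariance of I(s) and I(s') only sees the shorter interval. Hence I(s) - I(r) is orthogonal to
    I(u) for u <= r, and to constants because integrals have mean zero. In E[X(u) (I(s) - I(r))]
    only the drift of X(u) survives, which is why the integral equation is homogeneous. Once I(s)
    may be replaced by I(r) against the drift at time r, the product of the decompositions of X_i(s)
    and X_j(s) collapses to an integral of moments taken at a single time. The moment identity
    controls V in integrated form only, so no differential inequality is used: monotonicity gives (s
    - t) V(s) <= \int_t^s V, and coercivity of - L(P) with respect to P bounds that integral. *)

Lemma continuous_sumr (R : realType) (T : topologicalType) (I : Type)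
    (r : seq I) (F : I -> T -> R) :
  (forall i, continuous (F i)) -> continuous (fun x => \sum_(i <- r) F i x).
Proof.
by move=> cF; apply: continuous_big => //; exact: add_continuous.
Qed.

(** * Quadratic forms, positive definiteness and Rayleigh quotients *)

Section QuadraticForms.
Context {R : realType} {n : nat}.
Implicit Types (M N : 'M[R]_n) (u v : 'cV[R]_n).

Definition bform M u v : R := (u^T *m M *m v) 0 0.

Lemma bformDl M u u' v : bform M (u + u') v = bform M u v + bform M u' v.
Proof. by rewrite /bform linearD /= !mulmxDl mxE. Qed.

Lemma bformDr M u v v' : bform M u (v + v') = bform M u v + bform M u v'.
Proof. by rewrite /bform !mulmxDr mxE. Qed.

Lemma bformZl M a u v : bform M (a *: u) v = a * bform M u v.
Proof. by rewrite /bform linearZ /= -!scalemxAl mxE. Qed.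

Lemma bformZr M a u v : bform M u (a *: v) = a * bform M u v.
Proof. by rewrite /bform -scalemxAr mxE. Qed.

Lemma bformC M u v : M^T = M -> bform M u v = bform M v u.
Proof.
move=> symM; rewrite /bform.
have -> : u^T *m M *m v = (v^T *m M *m u)^T.
  by rewrite !trmx_mul trmxK symM mulmxA.
by rewrite mxE.
Qed.

Lemma bformDm M N u v : bform (M + N) u v = bform M u v + bform N u v.
Proof. by rewrite /bform mulmxDr mulmxDl mxE. Qed.

Lemma bformNm M u v : bform (- M) u v = - bform M u v.
Proof. by rewrite /bform mulmxN mulNmx mxE. Qed.

Lemma bformZm M a u v : bform (a *: M) u v = a * bform M u v.
Proof. by rewrite /bform -scalemxAr -scalemxAl mxE. Qed.

Lemma bformE M u v : bform M u v = \sum_i \sum_j M i j * (u i 0 * v j 0).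
Proof.
rewrite /bform mxE exchange_big /=; apply: eq_bigr => j _.
rewrite mxE big_distrl /=; apply: eq_bigr => i _.
by rewrite mxE; ring.
Qed.

Lemma bform1 u v : bform 1%:M u v = (u^T *m v) 0 0.
Proof. by rewrite /bform mulmx1. Qed.

Lemma posdef1 : posdefmx (1%:M : 'M[R]_n).
Proof.
split=> [|v v0]; first by rewrite trmx1.
rewrite mulmx1 mxE lt0r; apply/andP; split; last first.
  by apply: sumr_ge0 => i _; rewrite mxE -expr2 sqr_ge0.
apply: contra v0 => /eqP /psumr_eq0P v0; apply/eqP/matrixP => i j.
rewrite ord1 [RHS]mxE; apply/eqP; rewrite -sqrf_eq0 expr2; apply/eqP.
rewrite -[RHS](v0 _ i) ?mxE // => k _.
by rewrite mxE -expr2 sqr_ge0.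
Qed.

Lemma posdefmx_ge0 M v : posdefmx M -> 0 <= bform M v v.
Proof.
move=> [_ M0]; have [->|v0] := eqVneq v 0; first by rewrite /bform mulmx0 mxE.
exact/ltW/M0.
Qed.

Lemma posdefmxD M N : posdefmx M -> N^T = N ->
  (forall v, 0 <= bform N v v) -> posdefmx (M + N).
Proof.
move=> [sM M0] sN N0; split=> [|v v0]; first by rewrite linearD /= sM sN.
by rewrite -/(bform _ _ _) bformDm ltr_wpDr // M0.
Qed.

Lemma posdefmx_unit M : posdefmx M -> M \in unitmx.
Proof.
move=> [_ M0]; rewrite -row_free_unit -kermx_eq0; apply/rowV0P => u /sub_kermxP uM.
apply/eqP/negPn/negP => u0.
have := M0 u^T; rewrite trmxK uM mul0mx mxE ltxx => H.
suff: false by []. apply: H; apply: contra u0 => /eqP H.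
by rewrite -[u]trmxK H trmx0.
Qed.

(** A semidefinite form attains its minimum 0 at [v], so its first variation there vanishes in every
    direction. *)
Lemma psd_bform0 M v : M^T = M -> (forall u, 0 <= bform M u u) ->
  bform M v v = 0 -> forall u, bform M u v = 0.
Proof.
move=> sM M0 Mv u; apply/eqP/negPn/negP => b0.
pose q := bform M u u; pose b := bform M u v.
have q0 : 0 <= q by exact: M0.
(* Near-optimal step along [u]; the shift to [q + 1] avoids a case distinction on [q = 0] and still
   makes the value negative. *)
have := M0 (v + (- (b / (q + 1))) *: u).
rewrite !(bformDl, bformDr, bformZl, bformZr) Mv (bformC v u) // -/q -/b.
have q1 : q + 1 != 0 by rewrite gt_eqF // ltr_wpDl.
have -> : 0 + - (b / (q + 1)) * b +
  (- (b / (q + 1)) * b + - (b / (q + 1)) * (- (b / (q + 1)) * q)) =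
  - ((b / (q + 1)) ^+ 2 * (q + 2)) by field.
rewrite oppr_ge0 leNgt mulr_gt0 //; last by rewrite ltr_wpDl.
by rewrite lt0r sqr_ge0 andbT sqrf_eq0 mulf_neq0 // invr_eq0.
Qed.

(** The quotient is homogeneous of degree 0, so its minimum over the compact unit sphere of the
    matrix norm is a minimum over all nonzero vectors. Positive dimension makes the sphere
    nonempty. *)
Lemma exists_min_rayleigh M N : (0 < n)%N -> posdefmx N ->
  exists (lam : R) (v : 'cV[R]_n), [/\ v != 0, bform M v v = lam * bform N v v
    & forall u, lam * bform N u u <= bform M u u].
Proof.
move=> n0 [sN N0].
pose sph := [set u : 'rV[R]_n | `|u| = 1].
have csph : compact sph.
  apply: bounded_closed_compact.
    exists 1; split; first exact: num_real.
    by move=> x x1 y /= ->; exact: ltW.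
  rewrite [X in closed X](_ : _ = (fun u : 'rV[R]_n => `|u|) @^-1` [set 1]) //.
  apply: closed_comp; last exact: closed_eq.
  by move=> u _; exact: norm_continuous.
have cq L : continuous (fun u : 'rV[R]_n => bform L u^T u^T).
  under [X in continuous X]eq_fun do rewrite bformE.
  apply: continuous_sumr => i; apply: continuous_sumr => j u.
  have cj k : {for u, continuous (fun w : 'rV[R]_n => (w^T : 'cV[R]_n) k 0)}.
    rewrite (_ : (fun w => _) = (fun w : 'rV[R]_n => w 0 k)).
      exact: coord_continuous.
    by apply/funext => w; rewrite mxE.
  apply: (@continuousM R _ (fun=> L i j)
    (fun w : 'rV[R]_n => w^T i 0 * w^T j 0)); first exact: cst_continuous.
  by apply: continuousM; exact: cj.
pose f (u : 'rV[R]_n) := bform M u^T u^T / bform N u^T u^T.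
have Nne0 (w : 'rV[R]_n) : sph w -> bform N w^T w^T != 0.
  move=> w1; rewrite gt_eqF // N0 //; apply/eqP => wT0.
  move: w1; rewrite /sph /= -[w]trmxK wT0 trmx0 normr0 => /esym/eqP.
  by rewrite oner_eq0.
have [u usph fmin] : exists2 c, c \in sph & forall t, t \in sph -> f c <= f t.
  apply: EVT_min_rV => //.
    have u0 : (const_mx 1 : 'rV[R]_n) != 0.
      apply/eqP => /matrixP /(_ 0 (Ordinal n0)); rewrite !mxE => /eqP.
      by rewrite oner_eq0.
    exists (`|const_mx 1 : 'rV[R]_n|^-1 *: const_mx 1); rewrite /sph /=.
    by rewrite normrZ normfV normr_id mulVf // normr_eq0.
  apply/continuous_in_subspaceT => v /set_mem vs.
  apply: (@continuousM R _ (fun w : 'rV[R]_n => bform M w^T w^T)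
    (fun w : 'rV[R]_n => (bform N w^T w^T)^-1)); first exact: cq.
  by apply: (@continuousV R); [exact: Nne0|exact: cq].
have {usph}us : sph u by exact/set_mem.
have u0 : u^T != 0.
  by apply: contraNneq (Nne0 _ us) => ->; rewrite /bform mulmx0 mxE.
exists (f u), u^T; split => //; first by rewrite /f divfK // Nne0.
move=> v; have [->|v0] := eqVneq v 0; first by rewrite /bform !mulmx0 mxE mulr0.
have vT0 : v^T != 0 by apply: contra v0 => /eqP H; rewrite -[v]trmxK H trmx0.
have v1 : `|v^T| != 0 by rewrite normr_eq0.
have : f u <= f (`|v^T|^-1 *: v^T).
  by apply: fmin; rewrite inE /sph /= normrZ normfV normr_id mulVf.
rewrite {2}/f !linearZ /= trmxK !(bformZl, bformZr) -!mulf_div divff ?invr_eq0 //.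
by rewrite !mul1r ler_pdivlMr // N0.
Qed.
End QuadraticForms.

Section PositiveDefinite.
Context {R : realType} {n : nat}.
Implicit Types (M N : 'M[R]_n).

(** The constant is the minimal Rayleigh quotient of [M] with respect to [N]; it is positive because
    it is attained at a nonzero vector. In dimension 0 both forms vanish. *)
Lemma posdefmx_coercive M N : posdefmx M -> posdefmx N ->
  exists2 c : R, 0 < c & forall v, c * bform N v v <= bform M v v.
Proof.
move=> pM pN; have [n0|n0] := posnP n.
  exists 1 => // v; rewrite !bformE !big1 ?mulr0 // => i _;
  by have := ltn_ord i; rewrite [X in (_ < X)%N]n0.
have [lam [v [v0 Mv lamM]]] := exists_min_rayleigh M n0 pN.
exists lam => //; have [_ N0] := pN; have [_ M0] := pM.
by have := M0 _ v0; rewrite -/(bform _ _ _) Mv pmulr_lgt0 // N0.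
Qed.

End PositiveDefinite.

(** * The Lyapunov operator of a linear stochastic system *)

Section Lyapunov.
Context {R : realType} {n : nat}.
Variables F G : 'M[R]_n.
Implicit Types (P N : 'M[R]_n).

(** The generator of dX = F X ds + G X dW sends the function x^T P x to the quadratic form of this
    matrix; the last summand is the Ito correction. *)
Definition lyap P := P *m F + F^T *m P + G^T *m P *m G.

Lemma bform_lyap P u v : bform (lyap P) u v =
  bform P u (F *m v) + bform P (F *m u) v + bform P (G *m u) (G *m v).
Proof. by rewrite /lyap !bformDm /bform !trmx_mul !mulmxA. Qed.

Lemma lyap_lin a P N : lyap (P - a *: N) = lyap P - a *: lyap N.
Proof.
rewrite /lyap !(mulmxBl, mulmxBr) -!scalemxAr -!scalemxAl !scalerDr !opprD.
rewrite !scalemxAl; set x1 := P *m F; set x2 := _ *m N.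
by rewrite !addrA; apply/matrixP => i j; rewrite !mxE; ring.
Qed.

(* At a minimiser v of the Rayleigh quotient P / N with negative minimum lam,
   the semidefinite form P - lam N vanishes, so that its Lyapunov image is
   nonnegative there, against the signs of [lyap P] and [lyap N]. *)
Lemma lyap_posdefmx P N : P^T = P -> posdefmx (- lyap P) ->
  posdefmx N -> posdefmx (- lyap N) -> posdefmx P.
Proof.
move=> sP [_ LP] pN pLN; split=> // v v0.
have n0 : (0 < n)%N.
  case: (posnP n) v0 => // n0 /eqP []; apply/matrixP => i j.
  by have := ltn_ord i; rewrite [X in (_ < X)%N]n0.
have [lam [w [w0 Pw lamP]]] := exists_min_rayleigh P n0 pN.
have [sN N0] := pN.
suff lam0 : 0 < lam.
  by apply: lt_le_trans (lamP v); rewrite mulr_gt0 // N0.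
rewrite ltNge; apply/negP => lam0.
pose M := P - lam *: N.
have sM : M^T = M by rewrite /M linearB linearZ /= sP sN.
have M0 u : 0 <= bform M u u.
  by rewrite /M bformDm bformNm bformZm subr_ge0.
have Mw : bform M w w = 0 by rewrite /M bformDm bformNm bformZm Pw subrr.
have := psd_bform0 sM M0 Mw => Mw0.
have : 0 <= bform (lyap M) w w.
  by rewrite bform_lyap bformC // !Mw0 !add0r.
rewrite /M lyap_lin bformDm bformNm bformZm.
have := LP _ w0; rewrite -/(bform _ _ _) bformNm => LPw.
have := posdefmx_ge0 w pLN; rewrite bformNm => LNw.
rewrite leNgt; apply/negP; rewrite negbK.
have : 0 <= (- lam) * (- bform (lyap N) w w) by rewrite mulr_ge0 // oppr_ge0.
by rewrite mulrNN; lra.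
Qed.

End Lyapunov.

(** * Riccati identities and the learning iteration *)

Section GainIdentities.
Context {R : realType} {n m : nat}.
Variables (A C : 'M[R]_n) (B D : 'M[R]_(n, m)).

Definition closed_lyap (K : 'M[R]_(m, n)) := lyap (A + B *m K) (C + D *m K).

(* Completing the square around the feedback K = gain S P. *)
Lemma closed_lyapE (S : 'M[R]_m) (P : 'M[R]_n) (K L : 'M[R]_(m, n)) :
  S^T = S -> P^T = P -> S + D^T *m P *m D \in unitmx -> K = gain B C D S P ->
  closed_lyap L P = (A^T *m P + P *m A + C^T *m P *m C
     - K^T *m (S + D^T *m P *m D) *m K)
   + (L - K)^T *m (S + D^T *m P *m D) *m (L - K) - L^T *m S *m L.
Proof.
move=> sS sP uSig defK; set Sig := S + _ in uSig *.
have sSig : Sig^T = Sig.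
  by rewrite /Sig linearD /= !trmx_mul trmxK sS sP mulmxA.
have e1 : B^T *m P + D^T *m P *m C = - (Sig *m K).
  by rewrite defK /gain -/Sig mulmxN opprK mulKVmx.
have e2 : P *m B + C^T *m P *m D = - (K^T *m Sig).
  rewrite -[LHS]trmxK linearD /= !trmx_mul trmxK sP mulmxA e1.
  by rewrite linearN /= trmx_mul sSig.
have e3 : D^T *m P *m D = Sig - S by rewrite /Sig addrAC subrr add0r.
have -> : closed_lyap L P = A^T *m P + P *m A + C^T *m P *m C
    + (P *m B + C^T *m P *m D) *m L + L^T *m (B^T *m P + D^T *m P *m C)
    + L^T *m (D^T *m P *m D) *m L.
  rewrite /closed_lyap /lyap !linearD /= !trmx_mul.
  rewrite !(mulmxDl, mulmxDr) !mulmxA.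
  by apply/matrixP => i j; rewrite !mxE; ring.
rewrite e1 e2 e3 [(L - K)^T]linearB /=.
rewrite !(mulmxBl, mulmxBr, mulNmx, mulmxN) !mulmxA.
by apply/matrixP => i j; rewrite !mxE; ring.
Qed.

(** Supplies the invertibility of the matrix inverted in [gain], through [posdefmx_unit]. *)
Lemma gain_unit (S : 'M[R]_m) (P : 'M[R]_n) : posdefmx S -> posdefmx P ->
  posdefmx (S + D^T *m P *m D).
Proof.
move=> pS pP; apply: posdefmxD => //.
  by rewrite !trmx_mul trmxK pP.1 mulmxA.
move=> v; rewrite (_ : bform _ _ _ = bform P (D *m v) (D *m v)).
  exact: posdefmx_ge0.
by rewrite /bform trmx_mul !mulmxA.
Qed.

Lemma posdefmx_conj (k : nat) (S : 'M[R]_m) (K : 'M[R]_(m, k)) : posdefmx S ->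
  (K^T *m S *m K)^T = K^T *m S *m K /\
  forall v, 0 <= bform (K^T *m S *m K) v v.
Proof.
move=> pS; split; first by rewrite !trmx_mul trmxK pS.1 mulmxA.
move=> v; rewrite (_ : bform _ _ _ = bform S (K *m v) (K *m v)).
  exact: posdefmx_ge0.
by rewrite /bform trmx_mul !mulmxA.
Qed.

(** In [closed_lyapE] with [L = K] the square disappears, and the Riccati equation identifies the
    bracket with - Q. What is left is - Q - K^T S K. *)
Lemma riccati_lyap (Q : 'M[R]_n) (S : 'M[R]_m) (P : 'M[R]_n) :
  posdefmx Q -> posdefmx S -> posdefmx P -> riccati_eq A B C D Q S P ->
  posdefmx (- closed_lyap (gain B C D S P) P).
Proof.
move=> pQ pS pP ric; set K := gain _ _ _ _ _.
have pSig := gain_unit pS pP.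
rewrite (closed_lyapE K pS.1 pP.1 (posdefmx_unit pSig) erefl) subrr mulmx0 addr0.
set Sig := S + _ in pSig *.
suff -> : A^T *m P + P *m A + C^T *m P *m C - K^T *m Sig *m K = - Q.
  by rewrite opprB opprK addrC; apply: posdefmxD => //;
    have [] := posdefmx_conj K pS.
apply/eqP; rewrite -addr_eq0 -[X in _ == X]ric; apply/eqP.
have -> : (P *m B + C^T *m P *m D) *m invmx Sig *m (B^T *m P + D^T *m P *m C)
    = K^T *m Sig *m K.
  rewrite /K /gain -/Sig [(- _)^T]linearN /= trmx_mul trmx_inv pSig.1.
  rewrite [(B^T *m P + _)^T]linearD /= !trmx_mul !trmxK pP.1 !mulmxA.
  by rewrite !mulNmx mulmxN opprK !mulmxA mulmxKV // posdefmx_unit.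
by apply/matrixP => i j; rewrite !mxE; ring.
Qed.

(** The induction runs on the positivity of [Q i], which yields that of [P i] by comparison with
    [PT]. It propagates through the exact identity Q^{i+1} = Q^i + (KT - K^{i+1})^T (S + D^T P^i D)
    (KT - K^{i+1}). *)
Lemma irl_lyap (KT : 'M[R]_(m, n)) (S : 'M[R]_m) (Q0 : 'M[R]_n) P K Q PT :
  posdefmx PT -> posdefmx (- closed_lyap KT PT) -> posdefmx S -> posdefmx Q0 ->
  irl_iteration A B C D KT S Q0 P K Q ->
  forall i, posdefmx (P i) /\ posdefmx (- closed_lyap (K i.+1) (P i)).
Proof.
move=> pPT pLT pS pQ0 [Q0E iter].
have pP i : posdefmx (Q i) -> posdefmx (P i).
  move=> pQ; have [sP LP _ _] := iter i.
  apply: (lyap_posdefmx sP _ pPT pLT).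
  rewrite /lyap LP opprB opprK addrC.
  by apply: posdefmxD => //; have [] := posdefmx_conj KT pS.
have pQ i : posdefmx (Q i).
  elim: i => [|i IH]; first by rewrite Q0E.
  have [sP LP KE QE] := iter i.
  have pSig := gain_unit pS (pP _ IH).
  (* Two expressions for the Lyapunov image of [P i] under [KT], the completed square and the
     defining equation, are compared; the terms in KT^T S KT cancel. *)
  have := closed_lyapE KT pS.1 sP (posdefmx_unit pSig) KE.
  rewrite /closed_lyap /lyap LP QE => /eqP.
  set X := K i.+1; set Sig := S + _ in pSig *.
  have [sY pY] := posdefmx_conj (KT - X) pSig.
  set Y := _ *m _ *m (KT - X); rewrite -subr_eq0 => /eqP E.
  rewrite (_ : _ + _ = Q i + Y); first exact: posdefmxD.
  apply/eqP; rewrite -subr_eq0 -[X in _ == X]E; apply/eqP.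
  by apply/matrixP => r s; rewrite !mxE; ring.
move=> i; split; first exact: pP.
have [sP LP KE QE] := iter i.
have pSig := gain_unit pS (pP _ (pQ i)).
(* The same identity at the new gain: the square vanishes, leaving - Q^{i+1} - (K^{i+1})^T S
   K^{i+1}. *)
rewrite (closed_lyapE (K i.+1) pS.1 sP (posdefmx_unit pSig) KE).
rewrite subrr mulmx0 addr0.
have [sY pY] := posdefmx_conj (K i.+1) pS.
have := posdefmxD (pQ i.+1) sY pY; congr posdefmx.
by rewrite QE; apply/matrixP => r s; rewrite !mxE; ring.
Qed.

End GainIdentities.

(** * Square-integrable functions and their inner product *)

Section SquareIntegrable.
Context d (T : measurableType d) (R : realType).
Variables (mu : {measure set T -> \bar R}) (D : set T).
Hypothesis mD : measurable D.
Implicit Types f g : T -> R.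

Definition sqint f := measurable_fun D f /\
  mu.-integrable D (EFin \o (fun x => f x ^+ 2)).

(** One inner product serves for expectations over Omega, for integrals over a space-time strip and
    for time integrals along a path. The real-valued integral is total, so bilinearity carries
    [sqint] side conditions. *)
Definition ipr f g : R := \int[mu]_(x in D) (f x * g x).

Lemma integrable_le f g : measurable_fun D f ->
  mu.-integrable D (EFin \o g) -> (forall x, D x -> `|f x| <= g x) ->
  mu.-integrable D (EFin \o f).
Proof.
move=> mf ig fg; apply: le_integrable ig => //; first exact/measurable_EFinP.
by move=> x Dx /=; rewrite lee_fin (le_trans (fg x Dx)) // ler_norm.
Qed.

Lemma integrableDr f g : mu.-integrable D (EFin \o f) ->
  mu.-integrable D (EFin \o g) -> mu.-integrable D (EFin \o (f \+ g)).
Proof.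
move=> fi gi; have := integrableD mD fi gi.
by apply: eq_integrable => // x _.
Qed.

Lemma integrableZr_fun c f : mu.-integrable D (EFin \o f) ->
  mu.-integrable D (EFin \o (fun x => c * f x)).
Proof. by move=> fi; have := integrableZl mD c fi; exact: eq_integrable. Qed.

Lemma sqint_mul f g : sqint f -> sqint g ->
  mu.-integrable D (EFin \o (fun x => f x * g x)).
Proof.
move=> [mf fi] [mg gi].
apply: (@integrable_le _ (fun x => f x ^+ 2 + g x ^+ 2)).
- exact: measurable_funM.
- exact: integrableDr.
- move=> x _; rewrite normrM -(real_normK (num_real (f x))).
  rewrite -(real_normK (num_real (g x))).
  have := sqr_ge0 (`|f x| - `|g x|).
  have := normr_ge0 (f x); have := normr_ge0 (g x).
  by nra.
Qed.

Lemma sqintZ c f : sqint f -> sqint (fun x => c * f x).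
Proof.
move=> [mf fi]; split; first exact: measurable_funM.
have := integrableZr_fun (c ^+ 2) fi; apply: eq_integrable => // x _.
by rewrite /= exprMn.
Qed.

Lemma sqintD f g : sqint f -> sqint g -> sqint (fun x => f x + g x).
Proof.
move=> sf sg; have [mf fi] := sf; have [mg gi] := sg.
split; first exact: measurable_funD.
have := integrableDr (integrableDr fi gi) (integrableZr_fun 2 (sqint_mul sf sg)).
by apply: eq_integrable => // x _ /=; congr EFin; ring.
Qed.

Lemma sqintB f g : sqint f -> sqint g -> sqint (fun x => f x - g x).
Proof.
move=> sf sg; have := sqintD sf (sqintZ (-1) sg).
by under eq_fun do rewrite mulN1r.
Qed.

Lemma sqint0 : sqint (fun=> 0).
Proof.
split => //; under [X in integrable _ _ (_ \o X)]eq_fun do rewrite expr0n.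
exact: integrable0.
Qed.

Lemma sqint_sum (I : Type) (r : seq I) (P : pred I) (F : I -> T -> R) :
  (forall i, P i -> sqint (F i)) -> sqint (fun x => \sum_(i <- r | P i) F i x).
Proof.
move=> sF; elim: r => [|i r IH].
  by under [X in sqint X]eq_fun do rewrite big_nil; exact: sqint0.
under [X in sqint X]eq_fun do rewrite big_cons.
by case Pi: (P i) => //; apply: sqintD => //; exact: sF.
Qed.

Lemma iprC f g : ipr f g = ipr g f.
Proof. by apply: eq_Rintegral => x _; rewrite mulrC. Qed.

Lemma iprDl f g h : sqint f -> sqint g -> sqint h ->
  ipr (fun x => f x + g x) h = ipr f h + ipr g h.
Proof.
move=> sf sg sh; rewrite /ipr; under eq_Rintegral do rewrite mulrDl.
by rewrite RintegralD //; exact: sqint_mul.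
Qed.

Lemma iprZl c f h : sqint f -> sqint h ->
  ipr (fun x => c * f x) h = c * ipr f h.
Proof.
move=> sf sh; rewrite /ipr; under eq_Rintegral do rewrite -mulrA.
by rewrite RintegralZl //; exact: sqint_mul.
Qed.

Lemma iprBl f g h : sqint f -> sqint g -> sqint h ->
  ipr (fun x => f x - g x) h = ipr f h - ipr g h.
Proof.
move=> sf sg sh; rewrite /ipr; under eq_Rintegral do rewrite mulrBl.
by rewrite RintegralB //; exact: sqint_mul.
Qed.

Lemma iprDr f g h : sqint f -> sqint g -> sqint h ->
  ipr h (fun x => f x + g x) = ipr h f + ipr h g.
Proof. by move=> sf sg sh; rewrite iprC iprDl // !(iprC h). Qed.

Lemma iprBr f g h : sqint f -> sqint g -> sqint h ->
  ipr h (fun x => f x - g x) = ipr h f - ipr h g.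
Proof. by move=> sf sg sh; rewrite iprC iprBl // !(iprC h). Qed.

Lemma iprZr c f h : sqint f -> sqint h ->
  ipr h (fun x => c * f x) = c * ipr h f.
Proof. by move=> sf sh; rewrite iprC iprZl // iprC. Qed.

Lemma ipr_ge0 f : 0 <= ipr f f.
Proof. by apply: Rintegral_ge0 => x _; rewrite -expr2 sqr_ge0. Qed.

Lemma ipr_suml (I : Type) (r : seq I) (P : pred I) (F : I -> T -> R) h :
  (forall i, P i -> sqint (F i)) -> sqint h ->
  ipr (fun x => \sum_(i <- r | P i) F i x) h = \sum_(i <- r | P i) ipr (F i) h.
Proof.
move=> sF sh; elim: r => [|i r IH].
  rewrite big_nil; under [X in ipr X _]eq_fun do rewrite big_nil.
  rewrite /ipr; under eq_Rintegral do rewrite mul0r.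
  by rewrite Rintegral_cst // mul0r.
rewrite big_cons; under [X in ipr X _]eq_fun do rewrite big_cons.
case Pi: (P i) => //; rewrite iprDl //; [by rewrite IH|exact: sF|].
exact: sqint_sum.
Qed.

(** The polynomial t -> ||f + t g||^2 is nonnegative. It is evaluated at its minimizer when g has
    positive norm. *)
Lemma cauchy_schwarz f g : sqint f -> sqint g ->
  ipr f g ^+ 2 <= ipr f f * ipr g g.
Proof.
move=> sf sg.
have q t : 0 <= ipr f f + 2 * t * ipr f g + t ^+ 2 * ipr g g.
  have := ipr_ge0 (fun x => f x + t * g x).
  have stg := sqintZ t sg.
  rewrite iprDl ?iprDr ?iprZl ?iprZr //; try exact: sqintD.
  by rewrite (iprC g f); congr (_ <= _); ring.
have G0 := ipr_ge0 g; have [G|G] := eqVneq (ipr g g) 0; last first.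
  have := q (- (ipr f g / ipr g g)).
  rewrite (_ : _ + _ = (ipr f f * ipr g g - ipr f g ^+ 2) / ipr g g); last by field.
  by rewrite pmulr_lge0 ?subr_ge0 // invr_gt0 lt_neqAle eq_sym G.
rewrite G mulr0; have [->|b0] := eqVneq (ipr f g) 0; first by rewrite expr0n.
(* With [ipr g g = 0] the polynomial is affine in t with nonzero slope; this t makes it equal to
   -1. *)
have := q (- ((ipr f f + 1) / (2 * ipr f g))).
rewrite G mulr0 addr0 (_ : _ + _ = - 1); last by field.
by rewrite ler0N1.
Qed.

Lemma ipr_norm_le f g : sqint f -> sqint g ->
  `|ipr f g| <= Num.sqrt (ipr f f) * Num.sqrt (ipr g g).
Proof.
move=> sf sg; rewrite -sqrtrM ?ipr_ge0 // -sqrtr_sqr.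
by rewrite ler_sqrt ?mulr_ge0 ?ipr_ge0 // cauchy_schwarz.
Qed.

(** Joint continuity of the inner product in L^2. The error is expanded bilinearly in the
    differences [df] and [dg], and each term is bounded by Cauchy-Schwarz. *)
Lemma ipr_cvg (f g : T -> R) (fk gk : nat -> T -> R) :
  sqint f -> sqint g -> (forall k, sqint (fk k)) -> (forall k, sqint (gk k)) ->
  ipr (fun x => f x - fk k x) (fun x => f x - fk k x) @[k --> \oo] --> 0 ->
  ipr (fun x => g x - gk k x) (fun x => g x - gk k x) @[k --> \oo] --> 0 ->
  ipr (fk k) (gk k) @[k --> \oo] --> ipr f g.
Proof.
move=> sf sg sfk sgk cf cg.
pose df k x := f x - fk k x; pose dg k x := g x - gk k x.
have sdf k : sqint (df k) by exact: sqintB.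
have sdg k : sqint (dg k) by exact: sqintB.
have E k : ipr f g - ipr (fk k) (gk k) =
    ipr (df k) g + ipr f (dg k) - ipr (df k) (dg k).
  by rewrite /df /dg !(iprBl, iprBr) //; try exact: sqintB; ring.
have sq0 (u : nat -> R) : u k @[k --> \oo] --> (0 : R) ->
    Num.sqrt (u k) @[k --> \oo] --> (0 : R).
  move=> u0; rewrite -[X in _ --> X]sqrtr0.
  by apply: (cvg_comp u Num.sqrt u0); exact: sqrt_continuous.
pose bnd k := Num.sqrt (ipr (df k) (df k)) * Num.sqrt (ipr g g) +
  Num.sqrt (ipr f f) * Num.sqrt (ipr (dg k) (dg k)) +
  Num.sqrt (ipr (df k) (df k)) * Num.sqrt (ipr (dg k) (dg k)).
have bnd0 : bnd k @[k --> \oo] --> (0 : R).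
  rewrite -[X in _ --> X](_ : 0 * Num.sqrt (ipr g g) + Num.sqrt (ipr f f) * 0
     + 0 * 0 = 0); last by ring.
  by apply: cvgD; [apply: cvgD|]; apply: cvgM => //;
    first [exact: cvg_cst|exact: sq0].
have bnd_le k : `|ipr f g - ipr (fk k) (gk k)| <= bnd k.
  rewrite E (le_trans (ler_normB _ _)) // lerD ?ipr_norm_le //.
  by rewrite (le_trans (ler_normD _ _)) // lerD ?ipr_norm_le.
apply/cvgrPdist_le => e e0.
move/cvgrPdist_le : bnd0 => /(_ e e0); apply: filterS => k.
rewrite sub0r normrN; apply: le_trans; apply: le_trans (bnd_le k) _.
exact: ler_norm.
Qed.

End SquareIntegrable.

(** * Expectation of a product of independent variables *)

Section Independence.
Context d (Omega : measurableType d) (R : realType) (Pr : probability Omega R).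

(** Independence on rectangles forces the joint law to be the product of the marginal laws, by
    uniqueness of product measures. Tonelli applied to |x y| gives integrability of the product, and
    Fubini then gives the factorization. *)
Lemma Rintegral_indep (X Y : Omega -> R) :
  measurable_fun setT X -> measurable_fun setT Y ->
  (forall A B, measurable A -> measurable B ->
     Pr (X @^-1` A `&` Y @^-1` B) = (Pr (X @^-1` A) * Pr (Y @^-1` B))%E) ->
  Pr.-integrable setT (EFin \o X) -> Pr.-integrable setT (EFin \o Y) ->
  Pr.-integrable setT (EFin \o (fun w => X w * Y w)) /\
  \int[Pr]_w (X w * Y w) = \int[Pr]_w X w * \int[Pr]_w Y w.
Proof.
move=> mX mY XY iX iY.
pose X' : {RV Pr >-> R} := HB.pack X (isMeasurableFun.Build _ _ _ _ X mX).
pose Y' : {RV Pr >-> R} := HB.pack Y (isMeasurableFun.Build _ _ _ _ Y mY).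
pose Z w := (X w, Y w).
have mZ : measurable_fun setT Z by exact: measurable_fun_pair.
pose Z' : {RV Pr >-> (R * R)%type} :=
  HB.pack Z (isMeasurableFun.Build _ _ _ _ Z mZ).
pose mu := (distribution Pr X' \x distribution Pr Y')%E.
have muE A : measurable A -> mu A = distribution Pr Z' A.
  by move=> mA; apply: product_measure_unique => // A1 A2 mA1 mA2; exact: XY.

pose f (z : R * R) := (z.1 * z.2)%:E.
have mf : measurable_fun setT f.
  apply/measurable_EFinP; apply: measurable_funM.
    exact: measurable_fst.
  exact: measurable_snd.
have intE (g : R * R -> \bar R) : measurable_fun setT g ->
    (forall z, 0 <= g z)%E ->
    (\int[mu]_z g z = \int[Pr]_w g (Z w))%E.
  move=> mg g0; rewrite -(ge0_integral_distribution Z') //.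
  by apply: eq_measure_integral => A mA _; exact: muE.
have iXY : Pr.-integrable setT (EFin \o (fun w => X w * Y w)).
  apply/integrableP; split.
    by apply/measurable_EFinP; exact: measurable_funM.
  rewrite -(intE (fun z => `|f z|)%E) //; last exact: measurableT_comp.
  rewrite fubini_tonelli1 //; last exact: measurableT_comp.
  have mabs : measurable_fun [set: R] (fun y : R => `|y|%:E).
    by apply/measurable_EFinP; exact: normr_measurable.
  rewrite (eq_integral (fun x : R => `|x|%:E *
      \int[distribution Pr Y']_y `|y|%:E)%E); last first.
    move=> x _; rewrite /fubini_F /f /= -ge0_integralZl //.
    by apply: eq_integral => y _; rewrite normrM.
  rewrite ge0_integralZr //; [idtac|by apply: integral_ge0].
  rewrite (ge0_integral_distribution X' (f := fun x => `|x|%:E)) //.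
  rewrite (ge0_integral_distribution Y' (f := fun x => `|x|%:E)) //.
  have /integrableP[_ X1] := iX; have /integrableP[_ Y1] := iY.
  have X0 : (0 <= \int[Pr]_x ((fun x0 : R => `|x0|%:E) \o X') x)%E.
    by apply: integral_ge0 => x _; rewrite lee_fin.
  by rewrite lte_mul_pinfty // ge0_fin_numE.
split=> //.
have if_ : mu.-integrable setT f.
  apply/integrableP; split => //.
  have /integrableP[_] := iXY.
  by rewrite -(intE (fun z => `|f z|)%E) //; exact: measurableT_comp.
have mid : measurable_fun [set: R] (@EFin R) by exact/measurable_EFinP.
have EX : (\int[distribution Pr X']_x x%:E = \int[Pr]_w (X w)%:E)%E.
  exact: (integral_distribution (X := X') mid).
have EY : (\int[distribution Pr Y']_x x%:E = \int[Pr]_w (Y w)%:E)%E.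
  exact: (integral_distribution (X := Y') mid).
have idX : (distribution Pr X').-integrable setT (@EFin R).
  by apply: integrable_pushforward.
have idY : (distribution Pr Y').-integrable setT (@EFin R).
  by apply: integrable_pushforward.
have EY_fin : (\int[Pr]_w (Y w)%:E)%E \is a fin_num by exact: integrable_fin_num.
rewrite /Rintegral -fineM //; last exact: integrable_fin_num.
congr fine; transitivity (\int[distribution Pr Z']_z f z)%E.
  by rewrite (integral_distribution (X := Z')).
transitivity (\int[mu]_z f z)%E.
  by apply: eq_measure_integral => A mA _; exact/esym/muE.
rewrite -integral12_prod_meas1 // /fubini_F /f /=.
under eq_integral => x _.
  under eq_integral do rewrite EFinM.
  rewrite integralZl // EY -(fineK EY_fin).
  over.
by rewrite integralZr // EX fineK.
Qed.

End Independence.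

(** * Second moment of a centered Gaussian *)

Section NormalVariance.
Context {R : realType}.
Notation leb := (@lebesgue_measure R).

Variable sigma : R.
Hypothesis sigma0 : 0 < sigma.

Let p := normal_pdf 0 sigma.
(** Integration by parts in disguise: F' = p - (x / sigma)^2 p, so comparing the integral of p with
    that of (x / sigma)^2 p only needs boundary values of [F]. *)
Let F x := x * p x.
Let f x := p x - x ^+ 2 / sigma ^+ 2 * p x.

Let pE : p = (fun x => normal_peak sigma * expR (- x ^+ 2 / (sigma ^+ 2 *+ 2))).
Proof.
by apply/funext => x; rewrite /p normal_pdfE ?gt_eqF // /normal_fun subr0.
Qed.

Let s0 : sigma != 0. Proof. by rewrite gt_eqF. Qed.

Let p_ge0 x : 0 <= p x. Proof. exact: normal_pdf_ge0. Qed.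

Let derF (x : R) : is_derive x 1 F (f x).
Proof.
have d1 : is_derive x 1 (fun y : R => - y ^+ 2 / (sigma ^+ 2 *+ 2))
    (- x / sigma ^+ 2).
  rewrite (_ : (fun y => _) = (- (sigma ^+ 2 *+ 2)^-1) \*: (@id R ^+ 2)).
    apply: is_derive_eq; rewrite /= /GRing.scale /=; field.
    by rewrite s0.
  by apply/funext => y /=; rewrite /GRing.scale /= exprfctE mulrC mulrN mulNr.
have d2 := is_derive1_comp (is_derive_expR _) d1.
have -> : F = @id R * (normal_peak sigma \*: (expR \o
    (fun y : R => - y ^+ 2 / (sigma ^+ 2 *+ 2)))).
  by apply/funext => y; rewrite /F pE.
apply: is_derive_eq; rewrite /f pE /= /GRing.scale /=.
by field.
Qed.

Let cp : continuous p. Proof. exact: continuous_normal_pdf. Qed.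

Let cg : continuous (fun x : R => x ^+ 2 * p x).
Proof.
move=> x; apply: (@continuousM R _ (fun x : R => x ^+ 2) p); last exact: cp.
exact: exprn_continuous.
Qed.

Let cf : continuous f.
Proof.
move=> x; apply: (@continuousB R R^o _ p (fun x : R => x ^+ 2 / sigma ^+ 2 * p x)).
  exact: cp.
rewrite (_ : (fun x : R => x ^+ 2 / sigma ^+ 2 * p x) =
    (fun x : R => (sigma ^+ 2)^-1 * (x ^+ 2 * p x))).
  by apply: (@continuousM R R (fun=> _) (fun x => x ^+ 2 * p x));
    [exact: cst_continuous|exact: cg].
by apply/funext => y; ring.
Qed.

Let cF : continuous F.
Proof. by move=> x; apply: (@continuousM R R id p); [exact: cvg_id|exact: cp]. Qed.

(** From exp u >= u, the exponential factor is at most 2 sigma^2 / x^2, so F(x) = O(1 / x). *)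
Let F_cvg0 : F x @[x --> +oo] --> (0 : R).
Proof.
apply/cvgrPdist_le => e e0; near=> x.
have x0 : 0 < x by near: x; exact: nbhs_pinfty_gt.
rewrite sub0r normrN ger0_norm ?mulr_ge0 // ?(ltW x0) //.
have k0 := normal_peak_gt0 s0.
have c0 : 0 < sigma ^+ 2 *+ 2 by rewrite pmulrn_lgt0 // exprn_gt0.
have : normal_peak sigma * (sigma ^+ 2 *+ 2) / e <= x.
  by near: x; apply: nbhs_pinfty_ge; exact: num_real.
move: (sigma ^+ 2 *+ 2) c0 pE => c c0 pcE.
rewrite ler_pdivrMr // => xe.
have u0 : 0 < x ^+ 2 / c by rewrite divr_gt0 // exprn_gt0.
have ex : x ^+ 2 / c <= expR (x ^+ 2 / c).
  by rewrite (le_trans _ (expR_ge1Dx _)) // ler_wpDl.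
rewrite /F pcE mulNr expRN.
apply: (@le_trans _ _ (x * (normal_peak sigma * (x ^+ 2 / c)^-1))).
  by rewrite ler_wpM2l ?(ltW x0) // ler_wpM2l ?(ltW k0) // lef_pV2 ?posrE ?expR_gt0.
rewrite (_ : x * _ = normal_peak sigma * c / x).
  by rewrite ler_pdivrMr // [e * x]mulrC.
by field; rewrite (gt_eqF x0) (gt_eqF c0).
Unshelve. all: by end_near. Qed.

(** The derivative [f] changes sign at sigma only on the positive half-line. Cutting there lets each
    piece be treated with integrals of nonnegative functions; the boundary term F(sigma) appears
    once on each side and cancels. *)
Lemma normal_pdf_second_moment :
  (\int[leb]_x (x ^+ 2 * p x)%:E = (sigma ^+ 2)%:E)%E.
Proof.
pose g x := x ^+ 2 / sigma ^+ 2 * p x.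
have g_ge0 x : 0 <= g x by rewrite mulr_ge0 // divr_ge0 // sqr_ge0.
have mp : measurable_fun [set: R] p by exact: continuous_measurable_fun.
have mf : measurable_fun [set: R] f by exact: continuous_measurable_fun.
have gE : g = (fun x => (sigma ^+ 2)^-1 * (x ^+ 2 * p x)).
  by apply/funext => y; rewrite /g; ring.
have mg2 : measurable_fun [set: R] (fun x => x ^+ 2 * p x).
  exact: continuous_measurable_fun.
have mg : measurable_fun [set: R] g by rewrite gE; exact: measurable_funM.
have mT (h : R -> R) A : measurable_fun [set: R] h -> measurable_fun A (EFin \o h).
  by move=> mh; apply: measurable_funTS; apply/measurable_EFinP.
have left : (\int[leb]_(x in `[0%R, sigma[) (p x)%:E =
    (F sigma)%:E + \int[leb]_(x in `[0%R, sigma[) (g x)%:E)%E.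
  rewrite -(sube0 (F sigma)%:E) [X in (_ - X)%E](_ : _ = (F 0)%:E);
    last by rewrite /F mul0r.
  rewrite -(@continuous_FTC2 _ f F 0 sigma) //; first last.
  - by move=> x _; rewrite derive1E; have [] := derF x.
  - split; first by move=> x _; have [] := derF x.
      by apply: cvg_at_right_filter; exact: cF.
    by apply: cvg_at_left_filter; exact: cF.
  - by apply: continuous_subspaceT => x; exact: cf.
  rewrite -(@integral_itv_bndo_bndc _ _ _ (EFin \o f)) //; last exact: mT.
  rewrite -ge0_integralD //.
  - by apply: eq_integral => x _; rewrite -EFinD /f /g subrK.
  - move=> x /=; rewrite in_itv /= => /andP[x0 xs].
    rewrite lee_fin /f -[X in X - _]mul1r -mulrBl mulr_ge0 // subr_ge0.
    by rewrite ler_pdivrMr ?exprn_gt0 // mul1r ler_sqr ?nnegrE // ltW.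
  - exact: (mT f).
  - by move=> x _; rewrite lee_fin.
  - exact: (mT g).
have right : (\int[leb]_(x in `[sigma, +oo[) (g x)%:E =
    (F sigma)%:E + \int[leb]_(x in `[sigma, +oo[) (p x)%:E)%E.
  have nf_ge0 x : sigma <= x -> 0 <= - f x.
    move=> sx; rewrite /f opprB subr_ge0 -[leLHS]mul1r ler_wpM2r //.
    rewrite ler_pdivlMr ?exprn_gt0 // mul1r ler_sqr ?nnegrE ?(ltW sigma0) //.
    exact: le_trans (ltW sigma0) sx.
  have -> : (F sigma)%:E = (\int[leb]_(x in `[sigma, +oo[) (- f x)%:E)%E.
    rewrite (@ge0_continuous_FTC2y _ (fun x => - f x) (fun x => - F x) sigma 0) //.
    - by rewrite sub0e EFinN oppeK.
    - apply: continuous_subspaceT => x.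
      by apply: (@continuousN R R^o _ f); exact: cf.
    - by rewrite -oppr0; apply: cvgN.
    - by move=> x _; apply: derivableN; have [] := derF x.
    - apply: cvg_at_right_filter; apply: (@continuousN R R^o _ F); exact: cF.
    - move=> x _; rewrite derive1E deriveN; last by have [] := derF x.
      by have [_ ->] := derF x.
  rewrite -ge0_integralD //.
  - by apply: eq_integral => x _; rewrite -EFinD /f /g; congr EFin; ring.
  - by move=> x /=; rewrite in_itv /= andbT lee_fin => /nf_ge0.
  - by apply: (mT (fun x => - f x)); exact: measurableT_comp.
  - by move=> x _; rewrite lee_fin.
  - exact: (mT p).
have half (h : R -> R) : measurable_fun [set: R] h -> (forall x, 0 <= h x) ->
    (\int[leb]_(x in [set x | (0 <= x)%R]) (h x)%:E =
     \int[leb]_(x in `[0%R, sigma[) (h x)%:E +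
     \int[leb]_(x in `[sigma, +oo[) (h x)%:E)%E.
  move=> mh h0; rewrite -set_itvcy.
  rewrite (@itv_bndbnd_setU _ _ _ (BLeft sigma)) //; last by rewrite bnd_simp ltW.
  rewrite ge0_integral_setU //.
  - exact: (mT h).
  - by move=> x _; rewrite lee_fin.
  apply/disj_setPS => y [/=]; rewrite !in_itv /= => /andP[_ ys].
  by rewrite leNgt ys.
(* Both [g] and [p] are even, so equality of their integrals over the half-line suffices, and [p]
   has total mass 1. *)
have gp : (\int[leb]_x (g x)%:E = 1)%E.
  rewrite -(integral_normal_pdf 0 sigma) !ge0_symfun_integralT //.
  - rewrite (half g) // (half p) // left right; congr (_ * _)%E.
    by rewrite addeCA addeA.
  - by move=> x /=; rewrite -/p pE sqrrN.
  - by rewrite gE => x; apply: (@continuousM R R (fun=> _) (fun x => x ^+ 2 * p x));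
     [exact: cst_continuous|exact: cg].
  - by move=> x /=; rewrite /g pE sqrrN.
transitivity (\int[leb]_x ((sigma ^+ 2)%:E * (g x)%:E))%E.
  apply: eq_integral => x _; rewrite -EFinM gE; congr EFin.
  by field.
rewrite ge0_integralZl ?lee_fin ?sqr_ge0 //; first by rewrite gp mule1.
  exact: (mT g).
by move=> x _; rewrite lee_fin.
Qed.

End NormalVariance.

Section NormalProb.
Context {R : realType}.
Notation leb := (@lebesgue_measure R).

(** The Radon-Nikodym derivative of the normal law and its explicit density have the same integral
    over every measurable set, hence agree almost everywhere. *)
Lemma ge0_integral_normal_prob (m s : R) (f : R -> \bar R) :
  measurable_fun setT f -> (forall x, 0 <= f x)%E ->
  (\int[normal_prob m s]_x f x = \int[leb]_x (f x * (normal_pdf m s x)%:E))%E.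
Proof.
move=> mf f0.
pose h := Radon_Nikodym_SigmaFinite.f (normal_prob m s) leb.
have dom : normal_prob m s `<< leb by exact: normal_prob_dominates.
rewrite -(Radon_Nikodym_SigmaFinite.change_of_variables dom) //.
apply: ae_eq_integral => //.
- apply: emeasurable_funM => //; apply: (measurable_int leb).
  exact: Radon_Nikodym_SigmaFinite.f_integrable.
- apply: emeasurable_funM => //; apply/measurable_EFinP.
  exact: measurable_normal_pdf.
- apply: ae_eqe_mul2l; apply: integral_ae_eq => //.
  + exact: Radon_Nikodym_SigmaFinite.f_integrable.
  + by apply/measurable_EFinP; exact: measurable_normal_pdf.
  + move=> E _ mE; rewrite -Radon_Nikodym_SigmaFinite.f_integral //.
Qed.

Lemma normal_prob_second_moment (s : R) : 0 < s ->
  (\int[normal_prob 0%R s]_x (x ^+ 2)%:E = (s ^+ 2)%:E)%E.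
Proof.
move=> s0; rewrite ge0_integral_normal_prob.
- exact: normal_pdf_second_moment.
- by apply/measurable_EFinP; exact: measurable_funX.
- by move=> x; rewrite lee_fin sqr_ge0.
Qed.

End NormalProb.

(** * Fubini on the strip Omega x [a, b] *)

Section FubiniStrip.
Context d (Omega : measurableType d) (R : realType) (Pr : probability Omega R).
Notation leb := (@lebesgue_measure R).
Variables a b : R.
Local Notation RR := (measurableTypeR R).

Definition strip : set (Omega * RR) := setT `*` `[a, b].

Lemma measurable_strip : measurable strip.
Proof. exact: measurableX. Qed.

Definition prleb := (Pr \x leb)%E.

Let patch_strip (f : Omega * RR -> R) w r : ((EFin \o f) \_ strip) (w, r) =
  ((fun r => (f (w, r))%:E) \_ `[a, b]) r.
Proof. by rewrite !patchE /strip in_setX in_setT. Qed.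

Let measurable_patch_strip (f : Omega * RR -> R) : measurable_fun setT f ->
  measurable_fun setT ((EFin \o f) \_ strip).
Proof.
move=> mf; apply/(measurable_restrictT _ measurable_strip).
by apply: measurable_funTS; exact/measurable_EFinP.
Qed.

Let patch_strip_ge0 (f : Omega * RR -> R) : (forall z, 0 <= f z) ->
  forall z, (0 <= ((EFin \o f) \_ strip) z)%E.
Proof. by move=> f0 z; rewrite /patch; case: ifP => // _; rewrite lee_fin. Qed.

Lemma ge0_integral_strip (f : Omega * RR -> R) : measurable_fun setT f ->
  (forall z, 0 <= f z) ->
  (\int[prleb]_(z in strip) (f z)%:E =
   \int[Pr]_w \int[leb]_(r in `[a, b]) (f (w, r))%:E)%E.
Proof.
move=> mf f0; rewrite integral_mkcond /prleb fubini_tonelli1.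
- apply: eq_integral => w _; rewrite /fubini_F [RHS]integral_mkcond.
  by apply: eq_integral => r _; rewrite patch_strip.
- exact: measurable_patch_strip.
- exact: patch_strip_ge0.
Qed.

Lemma ge0_integral_strip_snd (f : Omega * RR -> R) : measurable_fun setT f ->
  (forall z, 0 <= f z) ->
  (\int[prleb]_(z in strip) (f z)%:E =
   \int[leb]_(r in `[a, b]) \int[Pr]_w (f (w, r))%:E)%E.
Proof.
move=> mf f0; rewrite integral_mkcond /prleb fubini_tonelli2.
- rewrite [RHS]integral_mkcond; apply: eq_integral => r _; rewrite /fubini_G.
  under eq_integral do rewrite patch_strip patchE.
  by rewrite patchE; case: ifPn => // _; rewrite integral0.
- exact: measurable_patch_strip.
- exact: patch_strip_ge0.
Qed.

(** Slices are required to be integrable for every [w], not just almost every one, so that the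
    real-valued inner integral is everywhere the finite part of a finite extended one. Continuous
    paths satisfy this. *)
Lemma Rintegral_strip (f : Omega * RR -> R) :
  prleb.-integrable strip (EFin \o f) ->
  (forall w, leb.-integrable `[a, b] (fun r => (f (w, r))%:E)) ->
  Pr.-integrable setT (fun w => (\int[leb]_(r in `[a, b]) f (w, r))%:E) /\
  \int[prleb]_(z in strip) f z =
    \int[Pr]_w \int[leb]_(r in `[a, b]) f (w, r).
Proof.
move=> intf intw; pose g := (EFin \o f) \_ strip.
have intg : prleb.-integrable setT g.
  exact: (integrable_mkcond _ measurable_strip).1.
have Fw w : fubini_F leb g w = (\int[leb]_(r in `[a, b]) f (w, r))%:E.
  rewrite /fubini_F /g /Rintegral fineK; last exact: integrable_fin_num.
  by rewrite [RHS]integral_mkcond; apply: eq_integral => r _; rewrite patch_strip.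
split.
  by apply: eq_integrable (integrable_fubini_F intg) => // w _; rewrite Fw.
rewrite /Rintegral [in LHS]integral_mkcond -(integral12_prod_meas1 intg).
by congr fine; apply: eq_integral => w _; rewrite Fw.
Qed.

Lemma Rintegral_strip_snd (f : Omega * RR -> R) :
  prleb.-integrable strip (EFin \o f) ->
  (forall r, a <= r <= b -> Pr.-integrable setT (fun w => (f (w, r))%:E)) ->
  leb.-integrable `[a, b] (fun r => (\int[Pr]_w f (w, r))%:E) /\
  \int[prleb]_(z in strip) f z =
    \int[leb]_(r in `[a, b]) \int[Pr]_w f (w, r).
Proof.
move=> intf intr; pose g := (EFin \o f) \_ strip.
have intg : prleb.-integrable setT g.
  exact: (integrable_mkcond _ measurable_strip).1.
have Gr r : fubini_G Pr g r =
    ((fun r => (\int[Pr]_w f (w, r))%:E) \_ `[a, b]) r.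
  rewrite /fubini_G /g; under eq_integral do rewrite patch_strip patchE.
  rewrite patchE; case: ifPn => rab; last by rewrite integral0.
  rewrite /Rintegral fineK //; apply: integrable_fin_num => //; apply: intr.
  by move: rab; rewrite inE /= in_itv.
have i2 : leb.-integrable setT (fubini_G Pr g).
  apply/integrableP; split; first exact: measurable_fubini_G intg.
  have /integrableP[mg] := intg.
  rewrite /prleb fubini_tonelli2 //; last exact: measurableT_comp.
  apply: le_lt_trans; apply: ge0_le_integral => //.
  - by apply: measurableT_comp => //; exact: measurable_fubini_G intg.
  - by apply: measurable_fun_fubini_tonelli_G => //; exact: measurableT_comp.
  - move=> r _; apply: le_abse_integral => //.
    by apply: measurableT_comp => //; exact: measurable_pair2.
split.
  apply/integrable_mkcond; first exact: measurable_itv.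
  by apply: eq_integrable i2 => // r _; rewrite Gr.
rewrite [LHS]/Rintegral integral_mkcond -(integral21_prod_meas1 intg).
rewrite [RHS]/Rintegral; congr fine.
by rewrite [RHS]integral_mkcond; apply: eq_integral => r _; rewrite Gr.
Qed.

End FubiniStrip.

(** * Moments of Brownian increments with adapted weights *)

Section BrownianMoments.
Context d (Omega : measurableType d) (R : realType) (Pr : probability Omega R).
Variable W : R -> {RV Pr >-> R}.
Hypothesis hW : standard_brownian_motion W.

Local Notation inc := (increment W).
Local Notation aug := (augmented_filtration W).
Implicit Types f g : Omega -> R.

Lemma measurable_increment s t : measurable_fun setT (inc s t).
Proof. by apply: measurable_funB. Qed.

Lemma augmented_filtration_measurable s A : aug s A -> measurable A.
Proof.
move: A; apply: (smallest_sub (@sigma_algebra_measurable _ Omega)).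
move=> B [[r _ [C mC <-]]|[]//].
exact: (@measurable_funPT _ _ _ _ (W r) measurableT C mC).
Qed.

Lemma measurable_wrt_measurable s f :
  measurable_wrt (aug s) f -> measurable_fun setT f.
Proof.
move=> mf _ B mB; apply: (@augmented_filtration_measurable s); apply: mf.
by exists B.
Qed.

Definition aug_gen s := past_events W s `|` [set N | measurable N /\ Pr N = 0%E].

(** Turns adaptedness into measurability on a type carrying the augmented sigma-algebra, which gives
    access to the closure properties of measurable functions. *)
Lemma measurable_wrtP s f : measurable_wrt (aug s) f <->
  measurable_fun [set: g_sigma_algebraType (aug_gen s)] (f : _ -> R).
Proof.
split=> [mf _ B mB|mf A [B mB <-]]; first by apply: mf; exists B.
exact: mf.
Qed.

Lemma aug_le s t A : s <= t -> aug s A -> aug t A.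
Proof.
move=> st; apply: sub_sigma_algebra2 => B [[r rs ?]|?]; last by right.
left; exists r => //; move: rs; rewrite /= !in_itv /= => /andP[-> rs].
exact: le_trans rs st.
Qed.

Lemma measurable_wrt_le s t f : s <= t -> measurable_wrt (aug s) f ->
  measurable_wrt (aug t) f.
Proof. by move=> st mf A /mf; exact: aug_le. Qed.

Lemma measurable_wrtM s f g : measurable_wrt (aug s) f ->
  measurable_wrt (aug s) g -> measurable_wrt (aug s) (fun w => f w * g w).
Proof.
by move=> /measurable_wrtP mf /measurable_wrtP mg; apply/measurable_wrtP;
  exact: measurable_funM.
Qed.

Lemma measurable_wrt_W r s : 0 <= r <= s -> measurable_wrt (aug s) (W r).
Proof.
move=> rs A AE; apply: sub_sigma_algebra; left; by exists r.
Qed.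

Lemma measurable_wrt_increment r s t : 0 <= r <= t -> 0 <= s <= t ->
  measurable_wrt (aug t) (inc r s).
Proof.
move=> rt st; have /measurable_wrtP mr := measurable_wrt_W rt.
have /measurable_wrtP ms := measurable_wrt_W st.
by apply/measurable_wrtP; exact: measurable_funB.
Qed.

Lemma probability_diff0 (A B C : set Omega) :
  measurable A -> measurable B -> measurable C ->
  Pr (A `\` B) = 0%E -> Pr (B `\` A) = 0%E -> Pr (A `&` C) = Pr (B `&` C).
Proof.
move=> mA mB mC.
suff H (A' B' : set Omega) : measurable A' -> measurable B' ->
    Pr (A' `\` B') = 0%E -> (Pr (A' `&` C) <= Pr (B' `&` C))%E.
  by move=> AB BA; apply/eqP; rewrite eq_le !H.
move=> mA' mB' AB0; rewrite -[leRHS]adde0 -AB0.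
have mAC := measurableI _ _ mA' mC; have mBC := measurableI _ _ mB' mC.
have mD := measurableD mA' mB'.
apply: le_trans (measureU2 _ _ _) => //.
apply: le_measure; rewrite ?inE //; first exact: measurableU.
by move=> w [A'w Cw]; have [B'w|nB'w] := pselect (B' w); [left|right].
Qed.

(** The measurable events that agree, up to null differences, with an event of the natural
    filtration form a sigma-algebra containing the generators. This carries independence, postulated
    for the natural filtration, over to the augmented one that governs adaptedness. *)
Lemma augmented_approx s A : aug s A ->
  exists B, [/\ natural_filtration W s B, measurable B, Pr (A `\` B) = 0%E &
    Pr (B `\` A) = 0%E].
Proof.
move=> augA; suff : [set A | measurable A /\ exists B,
  [/\ natural_filtration W s B, measurable B, Pr (A `\` B) = 0%E &
    Pr (B `\` A) = 0%E]] A by case.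
move: augA; apply: smallest_sub; last first.
  move=> B [pB|[mB B0]].
    have mB : measurable B.
      by apply: (@augmented_filtration_measurable s); apply: sub_sigma_algebra; left.
    split=> //; exists B; rewrite setDv measure0; split=> //.
    exact: sub_sigma_algebra.
  split=> //; exists set0; rewrite setD0 set0D measure0; split=> //.
  by have [] := smallest_sigma_algebra setT (past_events W s).
have [n0 nC nU] := smallest_sigma_algebra setT (past_events W s).
split=> [|B [mB [B' [nB' mB' BB' B'B]]]|B nB].
- by split=> //; exists set0; rewrite setDv measure0.
- split; first by rewrite setTD; exact: measurableC.
  exists (setT `\` B'); split; [exact: nC|by rewrite setTD; exact: measurableC|..].
  + by rewrite -[RHS]B'B; congr (Pr _); apply/seteqP; split=> w /=;
      [move=> [[_ nBw] /not_andP[//|/contrapT]]|move=> [? ?]; split=> // -[]].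
  + by rewrite -[RHS]BB'; congr (Pr _); apply/seteqP; split=> w /=;
      [move=> [[_ nBw] /not_andP[//|/contrapT]]|move=> [? ?]; split=> // -[]].
- have mB i : measurable (B i) by have [] := nB i.
  have /choice[B' B'P] i := (nB i).2.
  have mB' i : measurable (B' i) by have [] := B'P i.
  split; first exact: bigcupT_measurable.
  exists (\bigcup_i B' i); split.
  + by apply: nU => i; have [] := B'P i.
  + exact: bigcupT_measurable.
  + apply/eqP; rewrite eq_le measure_ge0 andbT.
    have mD i : measurable (B i `\` B' i) by exact: measurableD.
    apply: (@le_trans _ _ (\sum_(i <oo) Pr (B i `\` B' i))%E); last first.
      by rewrite eseries0 // => i _ _; have [] := B'P i.
    apply: measure_sigma_subadditive => //.
      by apply: measurableD; exact: bigcupT_measurable.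
    move=> w [[i _ Biw] nB'w]; exists i => //; split=> // B'iw.
    by apply: nB'w; exists i.
  + apply/eqP; rewrite eq_le measure_ge0 andbT.
    have mD i : measurable (B' i `\` B i) by exact: measurableD.
    apply: (@le_trans _ _ (\sum_(i <oo) Pr (B' i `\` B i))%E); last first.
      by rewrite eseries0 // => i _ _; have [] := B'P i.
    apply: measure_sigma_subadditive => //.
      by apply: measurableD; exact: bigcupT_measurable.
    move=> w [[i _ Biw] nB'w]; exists i => //; split=> // B'iw.
    by apply: nB'w; exists i.
Qed.

Lemma augmented_indep s t E B : 0 <= s -> s <= t -> aug s E -> measurable B ->
  Pr (E `&` inc s t @^-1` B) = (Pr E * Pr (inc s t @^-1` B))%E.
Proof.
move=> s0 st augE mB; have [_ _ indep _] := hW.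
have mE := augmented_filtration_measurable augE.
have [E' [nE' mE' EE' E'E]] := augmented_approx augE.
have mI : measurable (inc s t @^-1` B).
  by rewrite -[_ @^-1` _]setTI; exact: measurable_increment.
rewrite (probability_diff0 mE mE' mI) // indep //.
by rewrite -[E']setIT -[E]setIT (probability_diff0 mE mE' measurableT).
Qed.

Lemma integral_increment_sqr s t : 0 <= s -> s < t ->
  (\int[Pr]_w (inc s t w ^+ 2)%:E = (t - s)%:E)%E.
Proof.
move=> s0 st; have [_ _ _ law] := hW.
pose X : {RV Pr >-> measurableTypeR R} := HB.pack (inc s t)
  (isMeasurableFun.Build _ _ _ (measurableTypeR R) (inc s t)
    (measurable_increment s t)).
have st0 : 0 < Num.sqrt (t - s) by rewrite sqrtr_gt0 subr_gt0.
rewrite -[in RHS](@sqr_sqrtr _ (t - s)) ?subr_ge0 ?ltW //.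
rewrite -normal_prob_second_moment //.
transitivity (\int[distribution Pr X]_x (x ^+ 2)%:E)%E.
  rewrite ge0_integral_distribution //.
    by apply/measurable_EFinP; exact: measurable_funX.
  by move=> y; rewrite lee_fin sqr_ge0.
by apply: eq_measure_integral => B mB _; exact: law.
Qed.

Lemma sqint_increment s t : 0 <= s -> s <= t -> sqint Pr setT (inc s t).
Proof.
move=> s0; rewrite le_eqVlt => /predU1P[<-|st].
  rewrite (_ : inc s s = fun=> 0); first exact: sqint0.
  by apply/funext => w; rewrite /increment subrr.
split; first exact: measurable_increment.
apply/integrableP; split.
  apply/measurable_EFinP; apply: measurable_funX; exact: measurable_increment.
under eq_integral do rewrite /= ger0_norm ?sqr_ge0 //.
by rewrite integral_increment_sqr // ltry.
Qed.

Lemma ipr_increment s t : 0 <= s -> s <= t -> ipr Pr setT (inc s t) (inc s t) = t - s.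
Proof.
move=> s0; rewrite le_eqVlt => /predU1P[<-|st].
  rewrite /ipr; under eq_Rintegral do rewrite /increment subrr mul0r.
  by rewrite Rintegral_cst // mul0r subrr.
rewrite /ipr /Rintegral; under eq_integral do rewrite -expr2.
by rewrite integral_increment_sqr.
Qed.

Lemma sqint_cst c : sqint Pr setT (fun=> c).
Proof. by split => //; exact: finite_measure_integrable_cst. Qed.

Lemma sqint_integrable f : sqint Pr setT f -> Pr.-integrable setT (EFin \o f).
Proof.
move=> sf; have := sqint_mul measurableT sf (sqint_cst 1).
by apply: eq_integrable => // w _ /=; rewrite mulr1.
Qed.

Lemma Rintegral_wrt_increment s t f : 0 <= s -> s <= t ->
  measurable_wrt (aug s) f -> Pr.-integrable setT (EFin \o f) ->
  \int[Pr]_w (f w * inc s t w) = \int[Pr]_w f w * \int[Pr]_w inc s t w.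
Proof.
move=> s0 st wf fi; apply: (Rintegral_indep _ _ _ fi _).2.
- exact: measurable_wrt_measurable wf.
- exact: measurable_increment.
- move=> A B mA mB; apply: augmented_indep => //.
  by apply: wf; exists A => //; rewrite setTI.
- exact/sqint_integrable/sqint_increment.
Qed.

Lemma Rintegral_wrt_increment_sqr s t f : 0 <= s -> s <= t ->
  measurable_wrt (aug s) f -> Pr.-integrable setT (EFin \o f) ->
  \int[Pr]_w (f w * inc s t w ^+ 2) = \int[Pr]_w f w * (t - s).
Proof.
move=> s0 st wf fi.
have <- : \int[Pr]_w (inc s t w ^+ 2) = t - s.
  by rewrite -(ipr_increment s0 st); apply: eq_Rintegral => w _; rewrite expr2.
apply: (Rintegral_indep _ _ _ fi _).2.
- exact: measurable_wrt_measurable wf.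
- by apply: measurable_funX; exact: measurable_increment.
- move=> A B mA mB.
  rewrite (_ : _ @^-1` B = inc s t @^-1` ((fun x : R => x ^+ 2) @^-1` B)) //.
  apply: augmented_indep => //; first by apply: wf; exists A => //; rewrite setTI.
  by rewrite -[_ @^-1` B]setTI; exact: measurable_funX.
- by have [] := sqint_increment s0 st.
Qed.

(* The mean of an increment only depends on its length, so that comparing
   E (W_u - W_s)^2 with its two halves leaves twice the squared mean. *)
Lemma Rintegral_increment s t : 0 <= s -> s <= t -> \int[Pr]_w inc s t w = 0.
Proof.
move=> s0; rewrite le_eqVlt => /predU1P[<-|st].
  under eq_Rintegral do rewrite /increment subrr.
  by rewrite Rintegral_cst // mul0r.
pose u := t + (t - s); have tu : t < u by rewrite ltrDl subr_gt0.
have t0 : 0 <= t by rewrite (le_trans s0) // ltW.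
have sq1 := sqint_increment s0 (ltW st).
have sq2 := sqint_increment t0 (ltW tu).
have tuE : \int[Pr]_w inc t u w = \int[Pr]_w inc s t w.
  have [_ _ _ law] := hW.
  have E a b : 0 <= a -> a < b -> \int[Pr]_w inc a b w =
      \int[normal_prob 0 (Num.sqrt (b - a))]_x x.
    move=> a0 ab; rewrite /Rintegral; congr fine.
    pose X : {RV Pr >-> measurableTypeR R} := HB.pack (inc a b)
      (isMeasurableFun.Build _ _ _ (measurableTypeR R) (inc a b)
        (measurable_increment a b)).
    transitivity (\int[distribution Pr X]_x x%:E)%E.
      rewrite (integral_distribution (X := X)) //.
      exact/sqint_integrable/sqint_increment/ltW.
    by apply: eq_measure_integral => B mB _; exact: law.
  have ut : u - t = t - s by rewrite /u; ring.
  by rewrite (E t u t0 tu) (E s t s0 st) ut.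
have incD : inc s u = (fun w => inc s t w + inc t u w).
  by apply/funext => w; rewrite /increment; ring.
have := ipr_increment s0 (ltW (lt_trans st tu)).
have mT := @measurableT _ Omega.
rewrite incD (iprDl mT sq1 sq2 (sqintD mT sq1 sq2)).
rewrite (iprDr mT sq1 sq2 sq1) (iprDr mT sq1 sq2 sq2).
rewrite !ipr_increment ?(ltW st) ?(ltW tu) // (iprC _ _ (inc t u)).
rewrite {1 2}/ipr Rintegral_wrt_increment ?(ltW tu) //.
- rewrite tuE /u => H; apply/eqP; rewrite -sqrf_eq0 expr2; apply/eqP.
  by move: H; set e := \int[Pr]_w _; lra.
- by apply: measurable_wrt_increment; rewrite ?s0 ?t0 ?lexx ?ltW.
- exact: sqint_integrable.
Qed.

Lemma sqint_boundedM f g : measurable_fun setT f ->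
  (exists M : R, forall w, `|f w| <= M) -> sqint Pr setT g ->
  sqint Pr setT (fun w => f w * g w).
Proof.
move=> mf [M fM] [mg gi]; split; first exact: measurable_funM.
apply: (integrable_le measurableT (g := fun w => M ^+ 2 * g w ^+ 2)).
- by apply: measurable_funX; exact: measurable_funM.
- exact: integrableZr_fun.
- move=> w _; rewrite ger0_norm ?sqr_ge0 // exprMn ler_wpM2r ?sqr_ge0 //.
  rewrite -(real_normK (num_real (f w))) ler_sqr ?nnegrE //.
  exact: le_trans (fM w).
Qed.

Lemma sqint_bounded f : measurable_fun setT f ->
  (exists M : R, forall w, `|f w| <= M) -> sqint Pr setT f.
Proof.
move=> mf bf; have := sqint_boundedM mf bf (sqint_cst 1).
by under eq_fun do rewrite mulr1.
Qed.

(** For a <= b and c <= e, the length of the intersection of [a, b] and [c, e]. *)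
Definition overlap (a b c e : R) := Num.max 0 (Num.min b e - Num.max a c).

Definition bwrt s f := measurable_wrt (aug s) f /\ exists M : R, forall w, `|f w| <= M.

Lemma sqint_bwrtM s f g : bwrt s f -> sqint Pr setT g ->
  sqint Pr setT (fun w => f w * g w).
Proof. by move=> [/measurable_wrt_measurable mf bf]; exact: sqint_boundedM. Qed.

(** The product f g belongs to the past of [s], so it factors from the increment, which has mean
    zero. *)
Lemma ipr_future s t f g : 0 <= s -> s <= t -> sqint Pr setT f ->
  measurable_wrt (aug s) f -> bwrt s g ->
  ipr Pr setT f (fun w => g w * inc s t w) = 0.
Proof.
move=> s0 st sf wf bg; rewrite /ipr; under eq_Rintegral do rewrite mulrA.
rewrite (Rintegral_wrt_increment (f := fun w => f w * g w)) //.
- by rewrite Rintegral_increment // mulr0.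
- by apply: measurable_wrtM => //; have [] := bg.
- apply: sqint_mul => //; apply: sqint_bounded; last by have [] := bg.
  by have [/measurable_wrt_measurable] := bg.
Qed.

Lemma incD r s t : inc r t = (fun w => inc r s w + inc s t w).
Proof. by apply/funext => w; rewrite /increment; ring. Qed.

(** Split the longer increment at [e]: the part after [e] is orthogonal to everything known by then,
    and the squared common increment is independent of the weights. *)
Lemma ipr_same_start c e e' f g : 0 <= c -> c <= e -> e <= e' ->
  bwrt c f -> bwrt c g ->
  ipr Pr setT (fun w => f w * inc c e w) (fun w => g w * inc c e' w) =
  ipr Pr setT f g * (e - c).
Proof.
move=> c0 ce ee' bf bg; have e0 : 0 <= e by exact: le_trans ce.
have sce := sqint_increment c0 ce; have see := sqint_increment e0 ee'.
have mT := @measurableT _ Omega.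
rewrite (incD c e e'); under [X in ipr _ _ _ X]eq_fun do rewrite mulrDr.
have bge : bwrt e g by have [wg ?] := bg; split => //; exact: measurable_wrt_le wg.
have sf := sqint_bwrtM bf sce.
rewrite (iprDr mT (sqint_bwrtM bg sce) (sqint_bwrtM bge see) sf).
rewrite [X in _ + X]ipr_future // ?addr0; last first.
  apply: measurable_wrtM; first by have [wf ?] := bf; exact: measurable_wrt_le wf.
  by apply: measurable_wrt_increment; rewrite ?c0 ?e0 ?ce ?lexx.
rewrite /ipr -(Rintegral_wrt_increment_sqr (f := fun w => f w * g w)) //.
- by apply: eq_Rintegral => w _; ring.
- by have [wf ?] := bf; have [wg ?] := bg; exact: measurable_wrtM.
- have [/measurable_wrt_measurable mf ?] := bf.
  have [/measurable_wrt_measurable mg ?] := bg.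
  by apply: (sqint_mul mT); exact: sqint_bounded.
Qed.

(** If [a <= c], the part of the first increment before [c] lies in the past of the second, and the
    rest starts at the same time as the second. As the two intervals may be placed arbitrarily, two
    simple processes can be paired without a common refinement of their partitions. *)
Lemma ipr_weighted a b c e f g : 0 <= a -> a <= b -> 0 <= c -> c <= e ->
  bwrt a f -> bwrt c g ->
  ipr Pr setT (fun w => f w * inc a b w) (fun w => g w * inc c e w) =
  ipr Pr setT f g * overlap a b c e.
Proof.
wlog ac : a b c e f g / a <= c.
  move=> H a0 ab c0 cd bf bg; have [ac|/ltW ca] := leP a c; first exact: H.
  rewrite iprC (iprC _ _ f) H // /overlap; congr (_ * Num.max _ (_ - _)).
    exact: minC.
  exact: maxC.
move=> a0 ab c0 cd bf bg; rewrite /overlap (max_r ac).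
have bfc : bwrt c f by have [wf ?] := bf; split => //; exact: measurable_wrt_le wf.
have mT := @measurableT _ Omega.
have [bc|/ltW cb] := leP b c.
  rewrite ipr_future //; last 2 first.
  - by apply: sqint_bwrtM bf _; exact: sqint_increment.
  - apply: measurable_wrtM; first by have [] := bfc.
    by apply: measurable_wrt_increment; rewrite ?a0 ?(le_trans a0).
  by rewrite max_l ?mulr0 // subr_le0 ge_min bc.
have s1 : sqint Pr setT (fun w => f w * inc a c w).
  by apply: sqint_bwrtM bf _; exact: sqint_increment.
have s2 : sqint Pr setT (fun w => f w * inc c b w).
  by apply: sqint_bwrtM bf _; exact: sqint_increment.
have s3 : sqint Pr setT (fun w => g w * inc c e w).
  by apply: sqint_bwrtM bg _; exact: sqint_increment.
rewrite (incD a c b); under [X in ipr _ _ X _]eq_fun do rewrite mulrDr.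
rewrite iprDl // ipr_future // ?add0r; last first.
  apply: measurable_wrtM; first by have [] := bfc.
  by apply: measurable_wrt_increment; rewrite ?a0 ?c0 ?lexx ?ac.
have [be|/ltW eb] := leP b e; rewrite max_r ?subr_ge0 //.
  exact: ipr_same_start.
by rewrite iprC ipr_same_start // iprC.
Qed.

Section SimpleProcess.
Context {a b : R}.
Variable phi : simple_process W a b.
Hypothesis a0 : 0 <= a.

Lemma sp_time_homo i j : (i <= j <= sp_size phi)%N ->
  sp_time phi i <= sp_time phi j.
Proof.
move=> /andP[ij jn]; elim: j ij jn => [|j IH]; first by rewrite leqn0 => /eqP ->.
rewrite leq_eqVlt => /predU1P[-> //|]; rewrite ltnS => ij jn.
by apply: le_trans (IH ij (ltnW jn)) _; exact: sp_time_le.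
Qed.

Lemma sp_time_ge i : (i <= sp_size phi)%N -> a <= sp_time phi i.
Proof. by move=> ni; rewrite -[leLHS](sp_time_start phi) sp_time_homo. Qed.

Lemma sp_time_leb i : (i <= sp_size phi)%N -> sp_time phi i <= b.
Proof. by move=> ni; rewrite -[leRHS](sp_time_end phi) sp_time_homo // ni leqnn. Qed.

Lemma bwrt_sp_val (i : 'I_(sp_size phi)) : bwrt (sp_time phi i) (sp_val phi i).
Proof. by split; [exact: sp_val_adapted|exact: sp_val_bounded]. Qed.

Lemma sqint_sp_term (i : 'I_(sp_size phi)) : sqint Pr setT
  (fun w => sp_val phi i w * inc (sp_time phi i) (sp_time phi i.+1) w).
Proof.
apply: sqint_bwrtM (bwrt_sp_val i) _; apply: sqint_increment.
  by apply: le_trans (sp_time_ge _) => //; exact: ltnW.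
exact: sp_time_le.
Qed.

Lemma sqint_sp_integral : sqint Pr setT (sp_integral phi).
Proof. by apply: sqint_sum => // i _; exact: sqint_sp_term. Qed.

Lemma Rintegral_sp_integral : \int[Pr]_w sp_integral phi w = 0.
Proof.
have s1 := sqint_cst 1.
transitivity (ipr Pr setT (sp_integral phi) (fun=> 1)).
  by apply: eq_Rintegral => w _; rewrite mulr1.
rewrite ipr_suml //; last by move=> i _; exact: sqint_sp_term.
apply: big1 => i _; rewrite iprC ipr_future //.
- by apply: le_trans (sp_time_ge _) => //; exact: ltnW.
- exact: sp_time_le.
- by apply/measurable_wrtP; exact: measurable_cst.
- exact: bwrt_sp_val.
Qed.

End SimpleProcess.

Lemma ipr_sp_integral a b a' b' (phi : simple_process W a b)
    (psi : simple_process W a' b') : 0 <= a -> 0 <= a' ->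
  ipr Pr setT (sp_integral phi) (sp_integral psi) =
  \sum_(i < sp_size phi) \sum_(j < sp_size psi)
    ipr Pr setT (sp_val phi i) (sp_val psi j) *
    overlap (sp_time phi i) (sp_time phi i.+1) (sp_time psi j) (sp_time psi j.+1).
Proof.
move=> a0 a0'.
rewrite ipr_suml //; [|by move=> i _; exact: sqint_sp_term|exact: sqint_sp_integral].
apply: eq_bigr => i _; rewrite iprC ipr_suml //;
  [|by move=> j _; exact: sqint_sp_term|exact: sqint_sp_term].
apply: eq_bigr => j _; rewrite iprC ipr_weighted //.
- by apply: le_trans a0 (sp_time_ge _); exact: ltnW.
- exact: sp_time_le.
- by apply: le_trans a0' (sp_time_ge _); exact: ltnW.
- exact: sp_time_le.
- exact: bwrt_sp_val.
- exact: bwrt_sp_val.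
Qed.

End BrownianMoments.

(** * The Ito isometry for integrals with a common left end *)

Section ItoIsometry.
Context d (Omega : measurableType d) (R : realType) (Pr : probability Omega R).

Local Notation leb := (@lebesgue_measure R).
Local Notation RR := (measurableTypeR R).
Local Notation mu := (prleb Pr).

(** Only the first interval has to lie in [a, b]; this is what allows the second process to live on
    a longer interval. *)
Lemma Rintegral_indic_overlap (a b p q u v : R) : a <= p -> q <= b ->
  \int[leb]_(r in `[a, b]) (\1_(`[p, q[) r * \1_(`[u, v[) r) = overlap p q u v.
Proof.
move=> ap qb; rewrite /Rintegral.
have E : `[p, q[%classic `&` `[u, v[%classic =
    `[Num.max p u, Num.min q v[%classic :> set R.
  apply/seteqP; split=> x /=; rewrite !in_itv /= ge_max lt_min.
    by move=> [/andP[-> ->] /andP[-> ->]].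
  by move=> /andP[/andP[-> ->] /andP[-> ->]].
under eq_integral => x _.
  rewrite (_ : _ * _ = \1_(`[Num.max p u, Num.min q v[) x); last by rewrite -E indicI.
  over.
rewrite integral_indic //.
rewrite setIidl; last first.
  move=> x /=; rewrite !in_itv /= ge_max lt_min => /andP[/andP[px _] /andP[xq _]].
  by rewrite (le_trans ap px) (le_trans (ltW xq) qb).
rewrite [LHS](congr1 fine (lebesgue_measure_itv `[Num.max p u, Num.min q v[)).
rewrite /= lte_fin /overlap.
case: ltP => /= pq; first by rewrite [in RHS]max_r // subr_ge0 ltW.
by rewrite [in RHS]max_l // subr_le0.
Qed.

Section StripTerms.
Variables a b : R.
Local Notation D := (@strip _ Omega _ a b).

(** One step of a simple process seen on the strip; inner products of such functions split into an
    expectation times a time integral. *)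
Definition tensor (f : Omega -> R) (A : set R) (z : Omega * RR) : R := f z.1 * \1_A z.2.

Lemma measurable_tensor f (A : set R) : measurable_fun setT f -> measurable A ->
  measurable_fun setT (tensor f A).
Proof.
move=> mf mA; apply: measurable_funM.
  exact: (measurableT_comp mf (@measurable_fst _ _ Omega RR)).
exact: (measurableT_comp (@measurable_indic _ RR R setT A mA)
  (@measurable_snd _ _ Omega RR)).
Qed.

Lemma indic_itv_integrable (A : set R) : measurable A ->
  leb.-integrable `[a, b] (EFin \o (\1_A : RR -> R)).
Proof.
move=> mA; apply: measurable_bounded_integrable.
- exact: measurable_itv.
- by rewrite /= lebesgue_measure_itv /=; case: ifP => _; rewrite ?ltry // -EFinD ltry.
- by apply: measurable_funTS; exact: measurable_indic.
- exists 1; split; first exact: num_real.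
  by move=> M M1 r _ /=; rewrite indicE; case: (_ \in _);
    rewrite ?normr1 ?normr0 ltW // (lt_trans _ M1).
Qed.

Lemma sqint_tensor f (A : set R) : sqint Pr setT f -> measurable A ->
  sqint mu D (tensor f A).
Proof.
move=> [mf fi] mA; have mt := measurable_tensor mf mA; split.
  exact: measurable_funTS.
apply/integrableP; split.
  by apply/measurable_EFinP; apply: measurable_funTS; exact: measurable_funX.
under eq_integral do rewrite /= ger0_norm ?sqr_ge0 //.
rewrite ge0_integral_strip; [|exact: measurable_funX|by move=> z; exact: sqr_ge0].
pose c := (\int[leb]_(r in `[a, b]) (\1_A (r : RR))%:E)%E.
have c0 : (0 <= c)%E by apply: integral_ge0 => r _; rewrite lee_fin.
have c_fin : c \is a fin_num by apply: integrable_fin_num => //; exact: indic_itv_integrable.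
under eq_integral => w _.
  rewrite /tensor /=; under eq_integral => r _.
    rewrite exprMn (_ : \1_A r ^+ 2 = \1_A r); last first.
      by rewrite indicE; case: (_ \in _); rewrite ?expr1n ?expr0n.
    rewrite EFinM; over.
  rewrite ge0_integralZl //; last first.
  - by rewrite lee_fin sqr_ge0.
  - by apply/measurable_EFinP; apply: measurable_funTS; exact: measurable_indic.
  rewrite -/c; over.
have /integrableP[mf2 fi2] := fi.
rewrite ge0_integralZr //; last by move=> w _; rewrite lee_fin sqr_ge0.
rewrite -(fineK c_fin) lte_mul_pinfty ?ltry //.
  by apply: integral_ge0 => w _; rewrite lee_fin sqr_ge0.
exact: integrable_fin_num.
Qed.

Lemma ipr_tensor f g (A B : set R) : sqint Pr setT f -> sqint Pr setT g ->
  measurable A -> measurable B ->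
  ipr mu D (tensor f A) (tensor g B) =
  ipr Pr setT f g * \int[leb]_(r in `[a, b]) (\1_A r * \1_B r).
Proof.
move=> sf sg mA mB; have [mf _] := sf; have [mg _] := sg.
have mD := @measurable_strip _ Omega R a b.
have ifg := sqint_mul measurableT sf sg.
have iAB : leb.-integrable `[a, b] (EFin \o (fun r : RR => \1_A r * \1_B r)).
  have := indic_itv_integrable (measurableI _ _ mA mB).
  by apply: eq_integrable => // r _; rewrite /= indicI.
have slice w : leb.-integrable `[a, b]
    (fun r => (tensor f A (w, r) * tensor g B (w, r))%:E).
  have mab : @measurable _ RR `[a, b] by exact: measurable_itv.
  have := integrableZr_fun mab (f w * g w) iAB.
  by apply: eq_integrable => // r _; rewrite /tensor /=; congr EFin; ring.
have [||_ +] := @Rintegral_strip _ _ _ Pr a b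
    (fun z => tensor f A z * tensor g B z).
- by apply: sqint_mul => //; exact: sqint_tensor.
- by [].
rewrite /ipr => ->; rewrite -RintegralZr //; apply: eq_Rintegral => w _.
rewrite -RintegralZl //.
by apply: eq_Rintegral => r _; rewrite /tensor /=; ring.
Qed.

End StripTerms.

Section SimpleStrip.
Variable W : R -> {RV Pr >-> R}.
Hypothesis hW : standard_brownian_motion W.

Definition sp_fun a b (phi : simple_process W a b) (z : Omega * RR) : R :=
  sp_eval phi z.2 z.1.

Lemma sqint_sp_val a b (phi : simple_process W a b) (i : 'I_(sp_size phi)) :
  sqint Pr setT (sp_val phi i).
Proof.
apply: sqint_bounded; last exact: sp_val_bounded.
apply: measurable_wrt_measurable; exact: sp_val_adapted.
Qed.

Lemma sp_funE a b (phi : simple_process W a b) : sp_fun phi = (fun z =>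
  \sum_(i < sp_size phi) tensor (sp_val phi i) `[sp_time phi i, sp_time phi i.+1[ z).
Proof. by []. Qed.

Lemma measurable_sp_fun a b (phi : simple_process W a b) :
  measurable_fun setT (sp_fun phi).
Proof.
rewrite sp_funE; apply: measurable_sum => i.
by apply: measurable_tensor; [have [] := sqint_sp_val i|exact: measurable_itv].
Qed.

Lemma sqint_sp_fun a b (phi : simple_process W a b) p q :
  sqint mu (@strip _ Omega R p q) (sp_fun phi).
Proof.
rewrite sp_funE; apply: sqint_sum => [|i _]; first exact: measurable_strip.
by apply: sqint_tensor; [exact: sqint_sp_val|exact: measurable_itv].
Qed.

(** Both sides expand to the same double sum of E[phi_i psi_j] times the overlap of the i-th and
    j-th steps. *)
Lemma simple_isometry a b b' (phi : simple_process W a b)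
    (psi : simple_process W a b') : 0 <= a ->
  ipr Pr setT (sp_integral phi) (sp_integral psi) =
  ipr mu (@strip _ Omega R a b) (sp_fun phi) (sp_fun psi).
Proof.
move=> a0; rewrite ipr_sp_integral //.
have mD := @measurable_strip _ Omega R a b.
have st c (chi : simple_process W a c) (i : 'I_(sp_size chi)) : sqint mu (@strip _ Omega R a b)
    (tensor (sp_val chi i) `[sp_time chi i, sp_time chi i.+1[).
  by apply: sqint_tensor; [exact: sqint_sp_val|exact: measurable_itv].
rewrite {1}sp_funE ipr_suml //; last exact: sqint_sp_fun.
apply: eq_bigr => i _; rewrite [RHS]iprC sp_funE ipr_suml //.
apply: eq_bigr => j _; rewrite [RHS]iprC ipr_tensor.
- rewrite Rintegral_indic_overlap //; first by apply: sp_time_ge; exact: ltnW.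
  exact: sp_time_leb.
- exact: sqint_sp_val.
- exact: sqint_sp_val.
- exact: measurable_itv.
- exact: measurable_itv.
Qed.

End SimpleStrip.

Section ItoIntegral.
Variable W : R -> {RV Pr >-> R}.
Hypothesis hW : standard_brownian_motion W.
Local Notation D a b := (@strip _ Omega R a b).

(** Fubini needs a jointly measurable integrand on the whole product, so [h] stands in for [H], with
    which it agrees on [a, b]. The iterated extended integrals of [is_ito_integral] then become
    squared L^2 distances. *)
Lemma ito_approx (H : R -> Omega -> R) (h : Omega * RR -> R) a b (I : Omega -> R) :
  measurable_fun setT h -> sqint mu (D a b) h ->
  (forall r w, a <= r <= b -> H r w = h (w, r)) -> 0 <= a ->
  measurable_fun setT I -> is_ito_integral W H a b I ->
  sqint Pr setT I /\ exists phi : nat -> simple_process W a b,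
    ipr mu (D a b) (fun z => h z - sp_fun (phi k) z)
      (fun z => h z - sp_fun (phi k) z) @[k --> \oo] --> 0 /\
    ipr Pr setT (fun w => I w - sp_integral (phi k) w)
      (fun w => I w - sp_integral (phi k) w) @[k --> \oo] --> 0.
Proof.
move=> mh sh Hh a0 mI [phi [cH cI]].
have mD := @measurable_strip _ Omega R a b.
have sJ k : sqint Pr setT (sp_integral (phi k)) by exact: sqint_sp_integral.
have mJ k : measurable_fun setT (fun w => I w - sp_integral (phi k) w).
  by apply: measurable_funB => //; have [] := sJ k.
have sI : sqint Pr setT I.
  (* Convergence to a finite limit makes the error finite from some index [N] on, so [I] differs
     from a square-integrable variable by a square-integrable one. *)
  have /fine_cvgP[[N _ fN] _] := cI.
  have sd : sqint Pr setT (fun w => I w - sp_integral (phi N) w).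
    split; first exact: mJ.
    apply/integrableP; split; first by apply/measurable_EFinP; exact: measurable_funX.
    under eq_integral do rewrite /= ger0_norm ?sqr_ge0 //.
    have := fN N (leqnn N); rewrite /= unlock ge0_fin_numE //.
    by apply: integral_ge0 => w _; rewrite lee_fin sqr_ge0.
  have := sqintD measurableT sd (sJ N).
  by under eq_fun do rewrite subrK.
split=> //; exists phi; split.
  have /fine_cvgP[_] := cH; apply: cvg_trans; apply: near_eq_cvg.
  apply: nearW => k; rewrite /= /ipr /Rintegral; congr fine.
  under [RHS]eq_integral do rewrite -expr2.
  rewrite ge0_integral_strip.
  - apply: eq_integral => w _; apply: eq_integral => r /[!inE] /=.
    by rewrite in_itv /= => rab; rewrite Hh.
  - by apply: measurable_funX; apply: measurable_funB => //; exact: measurable_sp_fun.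
  - by move=> z; exact: sqr_ge0.
have /fine_cvgP[_] := cI; apply: cvg_trans; apply: near_eq_cvg.
apply: nearW => k; rewrite /= unlock /ipr /Rintegral; congr fine.
Qed.

Lemma ipr_strip_le a b b' (f : Omega * RR -> R) : b <= b' ->
  sqint mu (D a b') f -> ipr mu (D a b) f f <= ipr mu (D a b') f f.
Proof.
move=> bb' sf; have sub : D a b `<=` D a b'.
  move=> [w r] [_ /=]; rewrite in_itv /= => /andP[ar rb]; split=> //=.
  by rewrite in_itv /= ar (le_trans rb).
have mD := @measurable_strip _ Omega R a b.
have mD' := @measurable_strip _ Omega R a b'.
have i2 := sqint_mul mD' sf sf.
have i1 := integrableS mD' mD sub i2.
rewrite /ipr /Rintegral; apply: fine_le; [exact: integrable_fin_num..|].
apply: ge0_subset_integral => //; first exact: measurable_int i2.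
by move=> z _; rewrite lee_fin -expr2 sqr_ge0.
Qed.

Lemma sqint_strip_le a b b' (f : Omega * RR -> R) : b <= b' ->
  sqint mu (D a b') f -> sqint mu (D a b) f.
Proof.
move=> bb' [mf fi]; have sub : D a b `<=` D a b'.
  move=> [w r] [_ /=]; rewrite in_itv /= => /andP[ar rb]; split=> //=.
  by rewrite in_itv /= ar (le_trans rb).
have mD := @measurable_strip _ Omega R a b.
have mD' := @measurable_strip _ Omega R a b'.
by split; [exact: measurable_funS mf|exact: integrableS fi].
Qed.

(** Limit of [simple_isometry] on both sides. With [b < b'] it gives the covariance of the integral
    at two times and so does the work of the martingale property. *)
Lemma ito_isometry (H1 H2 : R -> Omega -> R) (h1 h2 : Omega * RR -> R) a b b'
    (I1 I2 : Omega -> R) : 0 <= a -> b <= b' ->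
  measurable_fun setT h1 -> measurable_fun setT h2 ->
  sqint mu (D a b) h1 -> sqint mu (D a b') h2 ->
  (forall r w, a <= r <= b -> H1 r w = h1 (w, r)) ->
  (forall r w, a <= r <= b' -> H2 r w = h2 (w, r)) ->
  measurable_fun setT I1 -> measurable_fun setT I2 ->
  is_ito_integral W H1 a b I1 -> is_ito_integral W H2 a b' I2 ->
  ipr Pr setT I1 I2 = ipr mu (D a b) h1 h2.
Proof.
move=> a0 bb' mh1 mh2 sh1 sh2 E1 E2 mI1 mI2 ito1 ito2.
have [sI1 [phi [cp1 cI1]]] := ito_approx mh1 sh1 E1 a0 mI1 ito1.
have [sI2 [psi [cp2 cI2]]] := ito_approx mh2 sh2 E2 a0 mI2 ito2.
have mD := @measurable_strip _ Omega R a b.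
have mD' := @measurable_strip _ Omega R a b'.
have c1 := ipr_cvg measurableT sI1 sI2 (fun k => sqint_sp_integral hW (phi k) a0)
  (fun k => sqint_sp_integral hW (psi k) a0) cI1 cI2.
have sh2' := sqint_strip_le bb' sh2.
(* The approximants of the longer integral are restricted to the shorter strip, where the error can
   only decrease. *)
have cp2' : ipr mu (D a b) (fun z => h2 z - sp_fun (psi k) z)
    (fun z => h2 z - sp_fun (psi k) z) @[k --> \oo] --> 0.
  apply: squeeze_cvgr cp2; last exact: cvg_cst.
  apply: nearW => k; rewrite ipr_ge0 ipr_strip_le //.
  by apply: sqintB => //; exact: sqint_sp_fun.
have c2 := ipr_cvg mD sh1 sh2' (fun k => sqint_sp_fun (phi k) a b)
  (fun k => sqint_sp_fun (psi k) a b) cp1 cp2'.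
have E k : ipr Pr setT (sp_integral (phi k)) (sp_integral (psi k)) =
    ipr mu (D a b) (sp_fun (phi k)) (sp_fun (psi k)) by exact: simple_isometry.
by move: c1; rewrite (funext E) => c1; exact: cvg_unique c1 c2.
Qed.

(** The mean is the inner product with the constant 1, hence L^2 continuous, and it vanishes on
    simple integrals. *)
Lemma Rintegral_ito (H : R -> Omega -> R) (h : Omega * RR -> R) a b (I : Omega -> R) :
  measurable_fun setT h -> sqint mu (D a b) h ->
  (forall r w, a <= r <= b -> H r w = h (w, r)) -> 0 <= a ->
  measurable_fun setT I -> is_ito_integral W H a b I ->
  \int[Pr]_w I w = 0.
Proof.
move=> mh sh E a0 mI ito.
have [sI [phi [_ cI]]] := ito_approx mh sh E a0 mI ito.
have s1 := sqint_cst Pr 1.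
have IE (f : Omega -> R) : ipr Pr setT f (fun=> 1) = \int[Pr]_w f w.
  by apply: eq_Rintegral => w _; rewrite mulr1.
have c := ipr_cvg measurableT sI s1 (fun k => sqint_sp_integral hW (phi k) a0)
  (fun=> s1) cI.
have /c {}c : ipr Pr setT (fun=> 1 - 1) (fun=> 1 - 1) @[k --> \oo] --> (0 : R).
  rewrite /ipr; under eq_Rintegral do rewrite subrr mul0r.
  by rewrite Rintegral_cst // mul0r; exact: cvg_cst.
have E0 k : ipr Pr setT (sp_integral (phi k)) (fun=> 1) = 0.
  by rewrite IE Rintegral_sp_integral.
rewrite (funext E0) in c; rewrite -IE.
by apply: (cvg_unique _ c); [exact: Rhausdorff|exact: cvg_cst].
Qed.

End ItoIntegral.

End ItoIsometry.

(** * Calculus along continuous paths *)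

Section PathFacts.
Context {R : realType}.
Notation leb := (@lebesgue_measure R).

(** Freezing a path before [t] trades continuity on a half-line for continuity on all of R. *)
Lemma continuous_maxl (t : R) (f : R -> R) :
  {within `[t, +oo[, continuous f} -> continuous (fun r => f (Num.max t r)).
Proof.
move=> /subspace_continuousP cf r.
have tr y : `[t, +oo[%classic (Num.max t y).
  by rewrite /= in_itv /= andbT le_max lexx.
apply: (cvg_comp (fun r => Num.max t r) f _ (cf _ (tr r))) => U /=.
have cmax : continuous (fun r => Num.max t r : R).
  by move=> x; apply: (@continuous_max R R (fun=> t) id); [exact: cvg_cst|exact: cvg_id].
move=> H; have := cmax r _ H; apply: (@filterS _ (nbhs r)) => y; apply; exact: tr.
Qed.

Lemma continuous_itv_integrable (f : R -> R) a b : continuous f ->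
  leb.-integrable `[a, b] (EFin \o f).
Proof.
move=> cf; apply: continuous_compact_integrable; first exact: segment_compact.
exact: continuous_subspaceT.
Qed.

Lemma derivable_Rintegral (f : R -> R) (t s : R) : continuous f -> t < s ->
  derivable (fun s => \int[leb]_(r in `[t, s]) f r) s 1 /\
  derive1 (fun s => \int[leb]_(r in `[t, s]) f r) s = f s.
Proof.
move=> cf ts.
apply: (@continuous_FTC1_closed _ f t s (s + 1)) => //.
- by rewrite ltrDl.
- exact: continuous_itv_integrable.
- exact: cf.
Qed.

Lemma Rintegral_shift_start (f : R -> R) (u t s : R) : continuous f ->
  u <= t -> t <= s ->
  \int[leb]_(r in `[t, s]) f r =
  \int[leb]_(r in `[u, s]) f r - \int[leb]_(r in `[u, t]) f r.
Proof.
move=> cf ut ts; rewrite Rintegral_itvB ?bnd_simp //.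
- rewrite Rintegral_itv_obnd_cbnd //.
  apply: integrableS (continuous_itv_integrable t s cf) => //.
  by apply: subset_itvr; rewrite bnd_simp.
- exact: continuous_itv_integrable.
Qed.

Lemma continuous_Rintegral (f : R -> R) (t : R) : continuous f ->
  continuous (fun s => \int[leb]_(r in `[t, Num.max t s]) f r).
Proof.
(* Starting the integral at [t - 1] makes [t] an interior point, so continuity follows from
   differentiability at every s >= t, the end point included. *)
move=> cf; pose B s := \int[leb]_(r in `[t - 1, s]) f r.
rewrite (_ : (fun s => _) = (fun s => B (Num.max t s) - B t)); last first.
  apply/funext => s; apply: Rintegral_shift_start => //; first by rewrite gerBl.
  by rewrite le_max lexx.
have cB s : t <= s -> {for s, continuous B}.
  move=> ts; apply: differentiable_continuous; apply/derivable1_diffP.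
  have ts1 : t - 1 < s by rewrite ltrBlDr ltr_pwDr.
  by have [] := derivable_Rintegral cf ts1.
move=> s; apply: (@continuousB R R^o _ (fun s => B (Num.max t s)) (fun=> B t));
  last exact: cst_continuous.
apply: continuous_comp; last by apply: cB; rewrite le_max lexx.
by apply: (@continuous_max R R (fun=> t) id); [exact: cvg_cst|exact: cvg_id].
Qed.

Lemma Rintegral_point (f : R -> R) (t : R) : \int[leb]_(r in `[t, t]) f r = 0.
Proof. by rewrite set_itv1 Rintegral_set1. Qed.

Lemma Rintegral_product_rule (f g : R -> R) (t s : R) : continuous f ->
  continuous g -> t <= s ->
  (\int[leb]_(r in `[t, s]) f r) * (\int[leb]_(r in `[t, s]) g r) =
  \int[leb]_(r in `[t, s]) (f r * \int[leb]_(u in `[t, r]) g u) +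
  \int[leb]_(r in `[t, s]) ((\int[leb]_(u in `[t, r]) f u) * g r).
Proof.
move=> cf cg; rewrite le_eqVlt => /predU1P[<-|ts].
  by rewrite !Rintegral_point mul0r addr0.
have LR (h : R -> R) : continuous h ->
    derivable_oo_LRcontinuous (fun s => \int[leb]_(r in `[t, s]) h r) t s.
  move=> ch.
  have := parameterized_integral_continuous (ltW ts) (continuous_itv_integrable t s ch).
  move=> /(continuous_within_itvP _ ts)[_ ct cs]; split => // x.
  by rewrite in_itv /= => /andP[tx _]; have [] := derivable_Rintegral ch tx.
have dE (h : R -> R) : continuous h ->
    {in `]t, s[, derive1 (fun s => \int[leb]_(r in `[t, s]) h r) =1 h}.
  move=> ch x; rewrite in_itv /= => /andP[tx _].
  by have [] := derivable_Rintegral ch tx.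
rewrite [X in _ + X](Rintegration_by_parts ts _ (LR f cf) (dE f cf) _ (LR g cg) (dE g cg));
  [|exact: continuous_subspaceT..].
by rewrite !Rintegral_point mul0r subr0 addrC subrK.
Qed.

End PathFacts.

(** * Uniqueness for a homogeneous linear integral system *)

Section Gronwall.
Context {R : realType}.
Notation leb := (@lebesgue_measure R).

(* Iterating the inequality from the bound M gives the bounds
   M 2^-N e^{2c(u-t)}. *)
Lemma vector_gronwall0 (I : finType) (D : I -> R -> R) (a : I -> I -> R)
    (t s M : R) :
  (forall k, leb.-integrable `[t, s] (EFin \o D k)) ->
  (forall k u, t <= u <= s -> `|D k u| <= M) ->
  (forall k u, t <= u <= s ->
     D k u = \int[leb]_(v in `[t, u]) \sum_l a k l * D l v) ->
  forall k u, t <= u <= s -> D k u = 0.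
Proof.
move=> iD DM DE.
(* A positive bound for all absolute row sums of the coefficients. The rate 2 c in the weight [e]
   makes c \int_t^u e at most e(u) / 2, so each iteration gains a factor 1/2. *)
pose c : R := \sum_k \sum_l `|a k l| + 1.
have c0 : 0 < c by rewrite ltr_wpDl // sumr_ge0 // => k _; rewrite sumr_ge0.
have rowc k : \sum_l `|a k l| <= c.
  rewrite /c [X in _ <= X + _](bigD1 k) //= -addrA lerDl addr_ge0 // sumr_ge0 // => j _.
  by rewrite sumr_ge0.
pose e v : R := expR (2 * c * (v - t)).
have ce : continuous e.
  move=> v; apply: continuous_comp; last exact: continuous_expR.
  apply: (@continuousM R R (fun=> 2 * c) (fun v => v - t)).
    exact: cst_continuous.
  by apply: (@continuousB R R^o _ id (fun=> t)); [exact: cvg_id|exact: cst_continuous].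
have de (v : R) : is_derive v 1 (fun v : R => (2 * c)^-1 * e v) (e v).
  have d1 : is_derive v 1 (fun v : R => 2 * c * (v - t)) (2 * c).
    rewrite (_ : (fun v => _) = (2 * c) \*: (@id R - cst t)) //.
    by apply: is_derive_eq; rewrite /GRing.scale /= subr0 mulr1.
  have d2 := is_derive1_comp (is_derive_expR _) d1.
  rewrite (_ : (fun v => _) = (2 * c)^-1 \*: (expR \o (fun v => 2 * c * (v - t)))) //.
  apply: is_derive_eq; rewrite /GRing.scale /= mulrCA mulVf ?mulr1 //.
  by rewrite mulf_neq0 // gt_eqF.
have inte u : t <= u -> \int[leb]_(v in `[t, u]) e v <= (2 * c)^-1 * e u.
  have c20 : 0 <= (2 * c)^-1 by rewrite invr_ge0 mulr_ge0 // ltW.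
  rewrite le_eqVlt => /predU1P[<-|tu].
    by rewrite Rintegral_point mulr_ge0 // expR_ge0.
  rewrite /Rintegral (@continuous_FTC2 _ e (fun v : R => (2 * c)^-1 * e v) t u) //=.
  - by rewrite lerBlDr lerDl mulr_ge0 // expR_ge0.
  - exact: continuous_subspaceT.
  - have cF (v : R) : {for v, continuous (fun v : R => (2 * c)^-1 * e v)}.
      by apply: differentiable_continuous; apply/derivable1_diffP; have [] := de v.
    split; first by move=> v _; have [] := de v.
      by apply: cvg_at_right_filter; exact: cF.
    by apply: cvg_at_left_filter; exact: cF.
  - by move=> v _; rewrite derive1E; have [] := de v.
have step N k u : t <= u <= s -> `|D k u| <= M / 2 ^+ N * e u.
  elim: N k u => [|N IH] k u tus.
    have M0 : 0 <= M by rewrite (le_trans (normr_ge0 _) (DM k u tus)).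
    rewrite expr0 divr1 (le_trans (DM k u tus)) // ler_peMr // -expR0 ler_expR.
    by rewrite mulr_ge0 ?subr_ge0 ?mulr_ge0 // ?(ltW c0) //; case/andP: tus.
  have [tu us] := andP tus.
  have mtu : @measurable _ (measurableTypeR R) `[t, u] by exact: measurable_itv.
  have mts : @measurable _ (measurableTypeR R) `[t, s] by exact: measurable_itv.
  have sub : `[t, u]%classic `<=` `[t, s]%classic.
    by apply: subset_itvl; rewrite bnd_simp.
  have iDu l : leb.-integrable `[t, u] (EFin \o D l) by exact: integrableS (iD l).
  have is_ : leb.-integrable `[t, u] (EFin \o (fun v => \sum_l a k l * D l v)).
    have : leb.-integrable `[t, u] (fun v => (\sum_l (a k l * D l v)%:E)%E).
      by apply: integrable_sum => // l _; exact: integrableZr_fun.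
    by apply: eq_integrable => // v _; rewrite /= sumEFin.
  have ie : leb.-integrable `[t, u] (EFin \o e) by exact: continuous_itv_integrable.
  rewrite DE // (le_trans (le_normr_Rintegral mtu is_)) //.
  apply: (@le_trans _ _ (\int[leb]_(v in `[t, u]) (c * (M / 2 ^+ N) * e v))).
    apply: le_Rintegral => //; [exact: integrable_norm|exact: integrableZr_fun|].
    move=> v /=; rewrite in_itv /= => /andP[tv vu].
    rewrite (le_trans (ler_norm_sum _ _ _)) //.
    apply: (@le_trans _ _ (\sum_l `|a k l| * (M / 2 ^+ N * e v))).
      apply: ler_sum => l _; rewrite normrM ler_wpM2l // IH // tv.
      exact: le_trans us.
    rewrite -mulr_suml -[leRHS]mulrA ler_wpM2r //.
    by rewrite (le_trans (normr_ge0 (D k v))) // IH // tv (le_trans vu).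
  rewrite RintegralZl //.
  have M0 : 0 <= M / 2 ^+ N.
    by rewrite divr_ge0 // ?exprn_ge0 // (le_trans (normr_ge0 _) (DM k u tus)).
  rewrite (le_trans (ler_wpM2l _ (inte u tu))) //.
    by rewrite mulr_ge0 // ltW.
  by rewrite exprS le_eqVlt; apply/orP; left; apply/eqP; field;
    rewrite expf_neq0 // gt_eqF.
move=> k u tus; apply/eqP; rewrite -normr_eq0 eq_le normr_ge0 andbT.
have cv : M / 2 ^+ N * e u @[N --> \oo] --> (0 : R).
  rewrite -[X in _ --> X](mul0r (e u)); apply: cvgM; last exact: cvg_cst.
  rewrite -[X in _ --> X](mulr0 M); apply: cvgM; first exact: cvg_cst.
  under eq_fun do rewrite -exprVn.
  by apply: cvg_expr; rewrite ger0_norm ?invr_ge0 // invf_lt1 // ltr1n.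
apply: (ler_cvg_to (cvg_cst _) cv); apply: nearW => N; exact: step.
Qed.

End Gronwall.

(** * Joint measurability of continuous processes *)

Section JointMeasurability.
Context d (Omega : measurableType d) (R : realType).
Local Notation RR := (measurableTypeR R).

Definition cont_process (Z : R -> Omega -> R) :=
  (forall w, continuous (fun r => Z r w)) /\ forall r, measurable_fun setT (Z r).

Lemma cvg_floor_grid (x : R) :
  (Num.floor (x * k.+1%:R))%:~R / k.+1%:R @[k --> \oo] --> x.
Proof.
have c1 : x - k.+1%:R^-1 @[k --> \oo] --> x.
  rewrite -[X in _ --> X]subr0; apply: cvgB; first exact: cvg_cst.
  exact: cvg_harmonic.
apply: squeeze_cvgr c1 (cvg_cst x).
apply: nearW => k; have k0 : 0 < k.+1%:R :> R by [].
rewrite ler_pdivrMr // floor_le andbT ler_pdivlMr // mulrBl mulVf ?gt_eqF //.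
have := floorD1_gt (x * k.+1%:R).
by rewrite intrD => /ltW; rewrite -lerBlDr.
Qed.

(* Z is the pointwise limit of its samplings along the grids Z / (k+1). *)
Lemma measurable_cont_process (Z : R -> Omega -> R) : cont_process Z ->
  measurable_fun setT (fun z : Omega * RR => Z z.2 z.1).
Proof.
move=> [cZ mZ].
pose h k (z : Omega * RR) := Z ((Num.floor (z.2 * k.+1%:R))%:~R / k.+1%:R) z.1.
apply: (@measurable_fun_cvg _ _ _ _ h); last first.
  move=> [w r] _; rewrite /h /=.
  have c : continuous (fun r => Z r w) := cZ w.
  by apply: (cvg_comp _ (fun r => Z r w)); [exact: cvg_floor_grid|exact: c].
move=> k.
(* Countable partition into the cells of the grid, on each of which [h k] does not depend on time.
   Cells are numbered by the encoding of integers, and [E n] is empty when [n] encodes none. *)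
pose E n : set (Omega * RR) :=
  snd @^-1` [set r : RR | Some (Num.floor (r * k.+1%:R)) = unpickle n].
have ET : \bigcup_n E n = setT.
  apply/seteqP; split=> // z _; exists (pickle (Num.floor (z.2 * k.+1%:R))) => //.
  by rewrite /E /= pickleK.
rewrite -ET; apply/measurable_fun_bigcup => n.
  rewrite -[E n]setTI; apply: measurable_snd => //.
  case: (unpickle n) => [m|]; last first.
    by rewrite (_ : [set _ | _] = set0) //; apply/seteqP; split.
  apply: is_interval_measurable => x y /= [xm] [ym] z /andP[xz zy].
  congr Some; apply/eqP; rewrite eq_le -{1}ym -{1}xm.
  by rewrite !le_floor // ler_wpM2r.
case nm : (unpickle n) => [m|]; last first.
  rewrite (_ : E n = set0); first exact: measurable_fun_set0.
  by apply/seteqP; split=> // z; rewrite /E /= nm.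
apply: (eq_measurable_fun (fun z => Z (m%:~R / k.+1%:R) z.1)).
  by move=> z; rewrite inE /E /= nm /h => -[->].
apply: measurable_funTS.
exact: (measurableT_comp (mZ _) (@measurable_fst _ _ Omega RR)).
Qed.

End JointMeasurability.

(** * Continuous processes as functions on the strip *)

Section ProcessStrip.
Context d (Omega : measurableType d) (R : realType) (Pr : probability Omega R).
Notation leb := (@lebesgue_measure R).
Local Notation RR := (measurableTypeR R).
Local Notation mu := (prleb Pr).
Local Notation D a b := (@strip _ Omega R a b).
Local Notation E2 := (ipr Pr setT).
Implicit Types (Z : R -> Omega -> R).

Definition joint Z (z : Omega * RR) : R := Z z.2 z.1.

Lemma cont_process_sum (I : Type) (r : seq I) (c : I -> R) (Z : I -> R -> Omega -> R) :
  (forall i, cont_process (Z i)) ->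
  cont_process (fun s w => \sum_(i <- r) c i * Z i s w).
Proof.
move=> pZ; split=> [w|s].
  apply: continuous_sumr => i s.
  apply: (@continuousM R R (fun=> c i) (fun s => Z i s w)).
    exact: cst_continuous.
  by have [cZ _] := pZ i; exact: cZ.
by apply: measurable_sum => i; apply: measurable_funM => //; have [_] := pZ i.
Qed.

Lemma cont_process_cst (f : Omega -> R) : measurable_fun setT f ->
  cont_process (fun=> f).
Proof. by move=> mf; split=> // w; exact: cst_continuous. Qed.

Lemma fine_leb_itv (a b : R) : a <= b -> fine (leb `[a, b]) = b - a.
Proof.
move=> ab; rewrite [LHS](congr1 fine (lebesgue_measure_itv `[a, b])) /= lte_fin.
case: ltP => //= ba; apply/esym/eqP; rewrite subr_eq0 eq_le ba.
by rewrite ab.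
Qed.

Variables a b : R.
Hypothesis ab : a <= b.

Let mD := @measurable_strip _ Omega R a b.
Let mab : @measurable _ RR `[a, b]. Proof. exact: measurable_itv. Qed.
Let mT := @measurableT _ Omega.

Lemma sqint_strip_bounded Z (M : R) : cont_process Z ->
  (forall r, a <= r <= b -> sqint Pr setT (Z r) /\ E2 (Z r) (Z r) <= M) ->
  sqint mu (D a b) (joint Z).
Proof.
move=> pZ bZ; have mj := measurable_cont_process pZ.
split; first exact: measurable_funTS.
apply/integrableP; split.
  by apply/measurable_EFinP; apply: measurable_funTS; exact: measurable_funX.
under eq_integral do rewrite /= ger0_norm ?sqr_ge0 //.
rewrite ge0_integral_strip_snd; [|exact: measurable_funX|by move=> z; exact: sqr_ge0].
apply: (@le_lt_trans _ _ (\int[leb]_(r in `[a, b]) M%:E)%E); last first.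
  rewrite integral_cst //= lebesgue_measure_itv /=.
  by case: ifP => _; rewrite ?mule0 ?ltry // -EFinD -EFinM ltry.
have M0 : 0 <= M.
  have aab : a <= a <= b by rewrite lexx.
  by apply: le_trans (ipr_ge0 _ _ _) (bZ a aab).2.
apply: ge0_le_integral => //.
- by move=> r _; apply: integral_ge0 => w _; rewrite lee_fin sqr_ge0.
- apply: measurable_funTS.
  apply: (measurable_fun_fubini_tonelli_G (fun z : Omega * RR => (joint Z z ^+ 2)%:E)).
    by apply/measurable_EFinP; exact: measurable_funX.
  by move=> z; rewrite lee_fin sqr_ge0.
- move=> r /=; rewrite in_itv /= => rab; have [[_ iZ] ZM] := bZ r rab.
  move: ZM; rewrite -lee_fin /ipr /Rintegral fineK; last first.
    by apply: integrable_fin_num => //; exact: sqint_mul (bZ r rab).1 (bZ r rab).1.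
  apply: le_trans; rewrite le_eqVlt; apply/orP; left; apply/eqP.
  by apply: eq_integral => w _; rewrite expr2.
Qed.

Lemma strip_swap Z Z' : cont_process Z -> cont_process Z' ->
  sqint mu (D a b) (joint Z) -> sqint mu (D a b) (joint Z') ->
  (forall r, a <= r <= b -> sqint Pr setT (Z r) /\ sqint Pr setT (Z' r)) ->
  [/\ leb.-integrable `[a, b] (EFin \o (fun r => E2 (Z r) (Z' r))),
     Pr.-integrable setT (EFin \o (fun w => \int[leb]_(r in `[a, b]) (Z r w * Z' r w))),
     \int[Pr]_w \int[leb]_(r in `[a, b]) (Z r w * Z' r w) =
     \int[leb]_(r in `[a, b]) E2 (Z r) (Z' r) &
     ipr mu (D a b) (joint Z) (joint Z') = \int[leb]_(r in `[a, b]) E2 (Z r) (Z' r)].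
Proof.
move=> pZ pZ' sZ sZ' sl.
have intf := sqint_mul mD sZ sZ'.
have [|i1 e1] := @Rintegral_strip _ _ _ Pr a b (fun z => joint Z z * joint Z' z) intf.
  move=> w; rewrite /joint /=; have [cZ _] := pZ; have [cZ' _] := pZ'.
  apply: (continuous_itv_integrable a b (f := fun r => Z r w * Z' r w)) => r.
  by apply: (@continuousM R R (Z ^~ w) (Z' ^~ w)); [exact: cZ|exact: cZ'].
have [|i2 e2] := @Rintegral_strip_snd _ _ _ Pr a b (fun z => joint Z z * joint Z' z) intf.
  by move=> r rab; have [s1 s2] := sl r rab; exact: sqint_mul.
by split=> //; rewrite -?e1.
Qed.

(** Cauchy-Schwarz in time against the constant 1, path by path, gives (\int Z)^2 <= (b - a) \int
    Z^2; then take expectations. *)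
Lemma sqint_time_integral Z : cont_process Z -> sqint mu (D a b) (joint Z) ->
  sqint Pr setT (fun w => \int[leb]_(r in `[a, b]) Z r w) /\
  E2 (fun w => \int[leb]_(r in `[a, b]) Z r w)
     (fun w => \int[leb]_(r in `[a, b]) Z r w) <=
  (b - a) * ipr mu (D a b) (joint Z) (joint Z).
Proof.
move=> pZ sZ; have [cZ _] := pZ.
have s1 : sqint mu (D a b) (joint (fun=> fun=> 1)).
  apply: (@sqint_strip_bounded _ (E2 (fun=> 1) (fun=> 1))) => [|r _].
    by apply: cont_process_cst; exact: measurable_cst.
  by split => //; exact: sqint_cst.
have icont (f : R -> R) : continuous f -> sqint leb `[a, b] f.
  move=> cf; split.
    apply: measurable_funTS; exact: continuous_measurable_fun.
  apply: (continuous_itv_integrable a b (f := fun r => f r ^+ 2)) => r.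
  by apply: (@continuousM R R f f); exact: cf.
have mA : measurable_fun setT (fun w => \int[leb]_(r in `[a, b]) Z r w).
  have i1 : mu.-integrable (D a b) (EFin \o joint Z).
    have := sqint_mul mD sZ s1; apply: eq_integrable => // z _.
    by rewrite /joint /= mulr1.
  have [|/(measurable_int Pr) /measurable_EFinP //] := Rintegral_strip i1.
  by move=> w; apply: (continuous_itv_integrable a b (f := Z ^~ w)) => r; exact: cZ.
have [|iq eq_] := @Rintegral_strip _ _ _ Pr a b (fun z => joint Z z * joint Z z)
    (sqint_mul mD sZ sZ).
  move=> w; rewrite /joint /=.
  apply: (continuous_itv_integrable a b (f := fun r => Z r w * Z r w)) => r.
  by apply: (@continuousM R R (Z ^~ w) (Z ^~ w)); exact: cZ.
pose q w := \int[leb]_(r in `[a, b]) (joint Z (w, r) * joint Z (w, r)).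
have ibq : Pr.-integrable setT (EFin \o (fun w => (b - a) * q w)).
  exact: integrableZr_fun.
have Aq w : (\int[leb]_(r in `[a, b]) Z r w) ^+ 2 <= (b - a) * q w.
  have := cauchy_schwarz mab (icont _ (cZ w)) (icont _ (@cst_continuous _ _ (1 : R))).
  rewrite mulrC [X in X * _](_ : _ = b - a); last first.
    by rewrite /ipr Rintegral_cst // !mul1r fine_leb_itv.
  rewrite [X in X ^+ 2](_ : _ = \int[leb]_(r in `[a, b]) Z r w) //.
  by rewrite /ipr; apply: eq_Rintegral => r _; rewrite mulr1.
have sA : sqint Pr setT (fun w => \int[leb]_(r in `[a, b]) Z r w).
  split => //; apply: (integrable_le mT (g := fun w => (b - a) * q w)) => //.
    exact: measurable_funX.
  by move=> w _; rewrite ger0_norm ?sqr_ge0 ?Aq.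
split=> //.
rewrite [X in _ * X](_ : _ = \int[Pr]_w q w) -?RintegralZl //.
apply: le_Rintegral => //; first exact: sqint_mul.
by move=> w _; rewrite -expr2 Aq.
Qed.

End ProcessStrip.

(** * Second moments of a linear stochastic system *)

Section LinearItoSystem.
Context d (Omega : measurableType d) (R : realType) (Pr : probability Omega R).
Variable W : R -> {RV Pr >-> R}.
Hypothesis hW : standard_brownian_motion W.
Notation leb := (@lebesgue_measure R).
Local Notation RR := (measurableTypeR R).
Local Notation mu := (prleb Pr).
Local Notation D a b := (@strip _ Omega R a b).
Local Notation E2 := (ipr Pr setT).
Let mT := @measurableT _ Omega.

Variables (n : nat) (F G : 'M[R]_n) (x : 'cV[R]_n) (t : R).
Hypothesis t0 : 0 <= t.
Variable Y : 'I_n -> R -> Omega -> R.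
Hypothesis pY : forall j, cont_process (Y j).
Hypothesis sY_strip : forall j s, t <= s -> sqint mu (D t s) (joint (Y j)).

Let f i r w := \sum_l F i l * Y l r w.
Let g i r w := \sum_l G i l * Y l r w.
Let A i s w := \int[leb]_(r in `[t, s]) f i r w.
Let I i s w := Y i s w - x i 0 - A i s w.

(** The integrand [H] is constrained on [t, s] only, so that the integrand built from the original
    solution can be used although [Y] will be a modification of it before [t]. *)
Hypothesis ito : forall i s, t <= s -> exists H : R -> Omega -> R,
  (forall r w, t <= r <= s -> H r w = g i r w) /\ is_ito_integral W H t s (I i s).

Let pf i : cont_process (f i). Proof. exact: cont_process_sum. Qed.
Let pg i : cont_process (g i). Proof. exact: cont_process_sum. Qed.

Let sf_strip i s : t <= s -> sqint mu (D t s) (joint (f i)).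
Proof.
move=> ts; apply: sqint_sum => [|l _]; first exact: measurable_strip.
by apply: sqintZ; [exact: measurable_strip|exact: sY_strip].
Qed.

Let sg_strip i s : t <= s -> sqint mu (D t s) (joint (g i)).
Proof.
move=> ts; apply: sqint_sum => [|l _]; first exact: measurable_strip.
by apply: sqintZ; [exact: measurable_strip|exact: sY_strip].
Qed.

Let sA i s : t <= s -> sqint Pr setT (A i s).
Proof. by move=> ts; have [] := sqint_time_integral ts (pf i) (sf_strip i ts). Qed.

Let mI i s : t <= s -> measurable_fun setT (I i s).
Proof.
move=> ts; apply: measurable_funB; last by have [] := sA i ts.
by apply: measurable_funB => //; have [_] := pY i.
Qed.

Let mg i := measurable_cont_process (pg i).

Let sI i s : t <= s -> sqint Pr setT (I i s).
Proof.
move=> ts; have [H [Hg itoH]] := ito i ts.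
by have [] := ito_approx hW (mg i) (sg_strip i ts) Hg t0 (mI i ts) itoH.
Qed.

Let EI i s : t <= s -> \int[Pr]_w I i s w = 0.
Proof.
move=> ts; have [H [Hg itoH]] := ito i ts.
exact: (Rintegral_ito hW (mg i) (sg_strip i ts) Hg t0 (mI i ts) itoH).
Qed.

Let covI i j s s' : t <= s -> s <= s' ->
  E2 (I i s) (I j s') = ipr mu (D t s) (joint (g i)) (joint (g j)).
Proof.
move=> ts ss'; have ts' := le_trans ts ss'.
have [H [Hg itoH]] := ito i ts; have [H' [Hg' itoH']] := ito j ts'.
exact: (ito_isometry hW t0 ss' (mg i) (mg j) (sg_strip i ts) (sg_strip j ts')
  Hg Hg' (mI i ts) (mI j ts') itoH itoH').
Qed.

Let YE i s : Y i s = (fun w => x i 0 + A i s w + I i s w).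
Proof. by apply/funext => w; rewrite /I; ring. Qed.

Let sY i s : t <= s -> sqint Pr setT (Y i s).
Proof.
by move=> ts; rewrite YE; apply: sqintD (sI i ts) => //; apply: sqintD (sA i ts) => //;
  exact: sqint_cst.
Qed.

Let sf i s : t <= s -> sqint Pr setT (f i s).
Proof. by move=> ts; apply: sqint_sum => // l _; apply: sqintZ => //; exact: sY. Qed.

Let sg i s : t <= s -> sqint Pr setT (g i s).
Proof. by move=> ts; apply: sqint_sum => // l _; apply: sqintZ => //; exact: sY. Qed.

Let A_bound i s T : t <= s -> s <= T ->
  E2 (A i s) (A i s) <= (T - t) * ipr mu (D t T) (joint (f i)) (joint (f i)).
Proof.
move=> ts sT; have tT := le_trans ts sT.
have [_ /le_trans] := sqint_time_integral ts (pf i) (sf_strip i ts); apply.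
rewrite ler_pM ?subr_ge0 ?ipr_ge0 ?lerD //.
by apply: ipr_strip_le sT _; exact: sf_strip.
Qed.

Let Y_bound T : t <= T -> exists M, forall i s, t <= s <= T -> E2 (Y i s) (Y i s) <= M.
Proof.
move=> tT.
(* The factor 3 comes from (p + q + r)^2 <= 3 (p^2 + q^2 + r^2) for the initial value, the drift and
   the stochastic integral. Since each [M i] is nonnegative, their sum is a bound uniform in [i]. *)
pose M i := 3 * (E2 (fun=> x i 0) (fun=> x i 0) +
  (T - t) * ipr mu (D t T) (joint (f i)) (joint (f i)) +
  ipr mu (D t T) (joint (g i)) (joint (g i))).
have M0 i : 0 <= M i.
  by rewrite mulr_ge0 // !addr_ge0 ?mulr_ge0 ?subr_ge0 ?ipr_ge0.
exists (\sum_i M i) => i s /andP[ts sT].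
apply: (@le_trans _ _ (M i)); last first.
  by rewrite (bigD1 i) //= lerDl sumr_ge0.
have s1 := sqint_cst Pr (x i 0); have s2 := sA i ts; have s3 := sI i ts.
apply: (@le_trans _ _ (3 * (E2 (fun=> x i 0) (fun=> x i 0) +
    E2 (A i s) (A i s) + E2 (I i s) (I i s)))); last first.
  rewrite /M ler_pM2l // lerD //; first by rewrite lerD // A_bound.
  by rewrite covI // ipr_strip_le //; exact: sg_strip.
have i1 := sqint_mul mT s1 s1; have i2 := sqint_mul mT s2 s2.
have i3 := sqint_mul mT s3 s3.
rewrite /ipr -!RintegralD //; last by have := integrableDr mT i1 i2; exact: eq_integrable.
have i123 : Pr.-integrable setT (EFin \o (fun w => x i 0 * x i 0 +
    A i s w * A i s w + I i s w * I i s w)).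
  have := integrableDr mT (integrableDr mT i1 i2) i3.
  by apply: eq_integrable => // w _.
rewrite -RintegralZl //; apply: le_Rintegral => //.
- by apply: sqint_mul => //; exact: sY.
- exact: integrableZr_fun.
- move=> w _; rewrite YE.
  move: (x i 0) (A i s w) (I i s w) => p q r.
  have := sqr_ge0 (p - q); have := sqr_ge0 (q - r); have := sqr_ge0 (p - r).
  by nra.
Qed.

Let E1 (h : Omega -> R) : E2 h (fun=> 1) = \int[Pr]_w h w.
Proof. by apply: eq_Rintegral => w _; rewrite mulr1. Qed.

Let sconst (z : Omega -> R) s : t <= s -> sqint Pr setT z ->
  sqint mu (D t s) (joint (fun=> z)).
Proof.
move=> ts sz; apply: (sqint_strip_bounded ts (M := E2 z z)) => //.
by apply: cont_process_cst; have [] := sz.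
Qed.

Let driftE i s (z : Omega -> R) : t <= s -> sqint Pr setT z ->
  leb.-integrable `[t, s] (EFin \o (fun r => E2 (f i r) z)) /\
  E2 (A i s) z = \int[leb]_(r in `[t, s]) E2 (f i r) z.
Proof.
move=> ts sz; have mz : measurable_fun setT z by have [] := sz.
have [|i1 _ e1 _] := strip_swap (pf i) (cont_process_cst mz)
    (sf_strip i ts) (sconst ts sz).
  by move=> r /andP[tr _]; split => //; exact: sf.
split => //; rewrite -e1; apply: eq_Rintegral => w _.
rewrite RintegralZr //.
apply: (continuous_itv_integrable t s (f := f i ^~ w)) => r.
by have [cf _] := pf i; exact: cf.
Qed.

Let fE2 i r (z : Omega -> R) : t <= r -> sqint Pr setT z ->
  E2 (f i r) z = \sum_l F i l * E2 (Y l r) z.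
Proof.
move=> tr sz; rewrite ipr_suml //.
  by apply: eq_bigr => l _; rewrite iprZl //; exact: sY.
by move=> l _; apply: sqintZ => //; exact: sY.
Qed.

(* The increments of I are orthogonal to the past values of Y, because the
   correlations D_k(u) = E (Y_k(u) (I_j(s) - I_j(r))) solve D = \int F D. *)
Let orthogonality j r s : t <= r -> r <= s -> forall k,
  E2 (Y k r) (I j s) = E2 (Y k r) (I j r).
Proof.
move=> tr rs k; have ts := le_trans tr rs.
pose z w := I j s w - I j r w.
have sz : sqint Pr setT z by apply: sqintB => //; exact: sI.
pose Dk k u := E2 (Y k u) z.
have DkE l u : t <= u <= r ->
    Dk l u = \int[leb]_(v in `[t, u]) \sum_m F l m * Dk m v.
  move=> /andP[tu ur]; rewrite /Dk YE.
  have s1 := sqint_cst Pr (x l 0).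
  rewrite (iprDl mT (sqintD mT s1 (sA l tu)) (sI l tu) sz).
  rewrite (iprDl mT s1 (sA l tu) sz).
  have -> : E2 (fun=> x l 0) z = 0.
    rewrite /ipr RintegralZl //; last exact: sqint_integrable.
    rewrite /z RintegralB //; [|exact/sqint_integrable/sI..].
    by rewrite !EI // subrr mulr0.
  have -> : E2 (I l u) z = 0.
    rewrite /z iprBr //; [|exact: sI..].
    by rewrite !covI ?subrr // (le_trans ur).
  rewrite add0r addr0 (driftE l tu sz).2; apply: eq_Rintegral => v.
  by rewrite inE /= in_itv /= => /andP[tv _]; rewrite fE2.
have [M YM] := Y_bound tr.
suff : Dk k r = 0.
  rewrite /Dk /z (iprBr mT (sI j ts) (sI j tr) (sY k tr)).
  by move/eqP; rewrite subr_eq0 => /eqP.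
apply: (vector_gronwall0 (a := fun i l => F i l) (t := t) (s := r)
  (M := Num.sqrt M * Num.sqrt (E2 z z))) => //; last by rewrite tr lexx.
- move=> l; have mz : measurable_fun setT z by have [] := sz.
  have [|i1 _ _ _] := strip_swap (pY l) (cont_process_cst mz)
    (sY_strip l tr) (sconst tr sz) => //.
  by move=> u /andP[tu _]; split => //; exact: sY.
- move=> l u tur; have [tu ur] := andP tur.
  rewrite (le_trans (ipr_norm_le mT (sY l tu) sz)) // ler_wpM2r ?sqrtr_ge0 //.
  by rewrite ler_wsqrtr // YM.
Qed.

(** [strip_swap] asks for paths continuous on all of R, hence the evaluation at [Num.max t s]; on
    [t, s] nothing changes. *)
Let cA i : cont_process (fun s => A i (Num.max t s)).
Proof.
split=> [w|s]; last first.
  by have [] := sA i (s := Num.max t s) _; rewrite ?le_max ?lexx.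
have [cf _] := pf i; exact: (continuous_Rintegral (cf w)).
Qed.

Let maxE r : t <= r -> Num.max t r = r. Proof. by move=> tr; rewrite max_r. Qed.

Let sA_strip i s : t <= s -> sqint mu (D t s) (joint (fun s => A i (Num.max t s))).
Proof.
move=> ts; apply: (sqint_strip_bounded ts (cA i)
  (M := (s - t) * ipr mu (D t s) (joint (f i)) (joint (f i)))) => r /andP[tr rs].
by rewrite maxE //; split; [exact: sA|exact: A_bound].
Qed.

Let driftA i j s : t <= s ->
  leb.-integrable `[t, s] (EFin \o (fun r => E2 (f i r) (A j r))) /\
  \int[Pr]_w \int[leb]_(r in `[t, s]) (f i r w * A j r w) =
  \int[leb]_(r in `[t, s]) E2 (f i r) (A j r) /\
  Pr.-integrable setT (EFin \o (fun w => \int[leb]_(r in `[t, s]) (f i r w * A j r w))).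
Proof.
move=> ts; have [|i1 i2 e1 _] := strip_swap (pf i) (cA j) (sf_strip i ts) (sA_strip j ts).
  by move=> r /andP[tr _]; rewrite maxE //; split; [exact: sf|exact: sA].
have eA r : r \in `[t, s]%classic -> A j (Num.max t r) = A j r.
  by rewrite inE /= in_itv /= => /andP[tr _]; rewrite maxE.
split; last split.
- apply: eq_integrable i1 => [|r rts]; first exact: measurable_itv.
  exact (congr1 (fun h => (E2 (f i r) h)%:E) (eA r rts)).
- transitivity (\int[leb]_(r in `[t, s]) E2 (f i r) (A j (Num.max t r))).
    rewrite -e1; apply: eq_Rintegral => w _; apply: eq_Rintegral => r rts.
    exact (congr1 (fun h => f i r w * h w) (esym (eA r rts))).
  by apply: eq_Rintegral => r rts; exact (congr1 (fun h => E2 (f i r) h) (eA r rts)).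
- apply: eq_integrable i2 => [|w _]; first exact: measurableT.
  refine (congr1 EFin _); apply: eq_Rintegral => r rts.
  exact (congr1 (fun h => f i r w * h w) (eA r rts)).
Qed.

(** The drift part is absolutely continuous, so the ordinary product rule holds path by path,
    without Ito correction. *)
Let AA i j s : t <= s -> E2 (A i s) (A j s) =
  \int[leb]_(r in `[t, s]) E2 (f i r) (A j r) +
  \int[leb]_(r in `[t, s]) E2 (f j r) (A i r).
Proof.
move=> ts; have [_ [e1 i1]] := driftA i j ts; have [_ [e2 i2]] := driftA j i ts.
rewrite -[X in X + _]e1 -[X in _ + X]e2; apply: (etrans _ (RintegralD mT i1 i2)).
apply: eq_Rintegral => w _.
have cf k : continuous (f k ^~ w) by have [cf _] := pf k; exact: cf.
rewrite (Rintegral_product_rule (cf i) (cf j) ts); congr (_ + _).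
by apply: eq_Rintegral => r _; rewrite mulrC.
Qed.

(** By orthogonality the terminal value [I j s] may be replaced under the integral by its value at
    the running time [r]. *)
Let driftI i j s : t <= s ->
  leb.-integrable `[t, s] (EFin \o (fun r => E2 (f i r) (I j r))) /\
  E2 (A i s) (I j s) = \int[leb]_(r in `[t, s]) E2 (f i r) (I j r).
Proof.
move=> ts; have [i1 e1] := driftE i ts (sI j ts).
have fI r : r \in `[t, s]%classic -> E2 (f i r) (I j s) = E2 (f i r) (I j r).
  rewrite inE /= in_itv /= => /andP[tr rs].
  rewrite (fE2 i tr (sI j ts)) (fE2 i tr (sI j tr)).
  apply: eq_bigr => l _.
  exact (congr1 (fun h => F i l * h) (orthogonality j tr rs l)).
split; last by rewrite e1; apply: eq_Rintegral => r rts; exact: fI.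
apply: eq_integrable i1 => [|r rts]; first exact: measurable_itv.
exact (congr1 EFin (fI r rts)).
Qed.

Let fY i j r : t <= r -> E2 (f i r) (Y j r) =
  x j 0 * E2 (f i r) (fun=> 1) + E2 (f i r) (A j r) + E2 (f i r) (I j r).
Proof.
move=> tr; have s1 := sqint_cst Pr 1; have sx := sqint_cst Pr (x j 0).
rewrite YE (iprDr mT (sqintD mT sx (sA j tr)) (sI j tr) (sf i tr)).
rewrite (iprDr mT sx (sA j tr) (sf i tr)); congr (_ + _ + _).
rewrite -iprZr //; last exact: sf.
by apply: eq_Rintegral => w _; rewrite mulr1.
Qed.

Lemma second_moment_integrable i j s : t <= s ->
  leb.-integrable `[t, s] (EFin \o (fun r => E2 (Y i r) (Y j r))).
Proof.
move=> ts; have [|i1 _ _ _] := strip_swap (pY i) (pY j) (sY_strip i ts) (sY_strip j ts).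
  by move=> r /andP[tr _]; split; exact: sY.
by [].
Qed.

Lemma sqint_solution i s : t <= s -> sqint Pr setT (Y i s).
Proof. exact: sY. Qed.

Lemma drift_moment_integrable i j s : t <= s ->
  leb.-integrable `[t, s] (EFin \o (fun r => E2 (f i r) (Y j r))).
Proof.
move=> ts; have [|i1 _ _ _] := strip_swap (pf i) (pY j) (sf_strip i ts) (sY_strip j ts).
  by move=> r /andP[tr _]; split; [exact: sf|exact: sY].
by [].
Qed.

Lemma diffusion_moment_integrable i j s : t <= s ->
  leb.-integrable `[t, s] (EFin \o (fun r => E2 (g i r) (g j r))).
Proof.
move=> ts; have [|i1 _ _ _] := strip_swap (pg i) (pg j) (sg_strip i ts) (sg_strip j ts).
  by move=> r /andP[tr _]; split; exact: sg.
by [].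
Qed.

(** Expand the product of the decompositions x + A + I. The covariance of the two stochastic
    integrals is the diffusion term by the isometry, the products of x with I have mean zero, and
    all terms containing A recombine into the moments of f against Y. *)
Lemma second_moment i j s : t <= s ->
  E2 (Y i s) (Y j s) = x i 0 * x j 0 +
  \int[leb]_(r in `[t, s])
    (E2 (f i r) (Y j r) + E2 (f j r) (Y i r) + E2 (g i r) (g j r)).
Proof.
move=> ts.
have mts : @measurable _ RR `[t, s] by exact: measurable_itv.
have s1 := sqint_cst Pr 1.
have ifY k l := drift_moment_integrable k l ts.
have igg := diffusion_moment_integrable i j ts.
have EfY k l : \int[leb]_(r in `[t, s]) E2 (f k r) (Y l r) =
    x l 0 * E2 (A k s) (fun=> 1) + \int[leb]_(r in `[t, s]) E2 (f k r) (A l r) +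
    E2 (A k s) (I l s).
  have [ik1 ->] := driftE k ts s1; have [ikI ->] := driftI k l ts.
  have [ikA _] := driftA k l ts.
  rewrite -RintegralZl // -RintegralD //; last exact: integrableZr_fun.
  rewrite -RintegralD //; last first.
    by have := integrableDr mts (integrableZr_fun mts (x l 0) ik1) ikA;
      apply: eq_integrable.
  by apply: eq_Rintegral => r; rewrite inE /= in_itv /= => /andP[tr _]; exact: fY.
have sumD k l : leb.-integrable `[t, s]
    (EFin \o (fun r => E2 (f k r) (Y l r) + E2 (f l r) (Y k r))).
  by have := integrableDr mts (ifY k l) (ifY l k); apply: eq_integrable.
rewrite RintegralD // RintegralD // !EfY.
have -> : \int[leb]_(r in `[t, s]) E2 (g i r) (g j r) = E2 (I i s) (I j s).
  rewrite covI //.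
  have [|_ _ _ ->] := strip_swap (pg i) (pg j) (sg_strip i ts) (sg_strip j ts) => //.
  by move=> r /andP[tr _]; split; exact: sg.
have sA_ k := sA k ts; have sI_ k := sI k ts.
have sx k := sqint_cst Pr (x k 0).
have sxA k := sqintD mT (sx k) (sA_ k).
have ex k h : sqint Pr setT h -> E2 (fun=> x k 0) h = x k 0 * E2 h (fun=> 1).
  move=> sh; rewrite iprC -iprZr //; apply: eq_Rintegral => w _.
  by rewrite mulr1.
have exx : E2 (fun=> x i 0) (fun=> x j 0) = x i 0 * x j 0.
  rewrite /ipr Rintegral_cst //= probability_setT /= mulr1 //.
rewrite !YE (iprDl mT (sxA i) (sI_ i) (sqintD mT (sxA j) (sI_ j))).
rewrite (iprDr mT (sxA j) (sI_ j) (sxA i)) (iprDr mT (sxA j) (sI_ j) (sI_ i)).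
rewrite (iprDl mT (sx i) (sA_ i) (sxA j)) (iprDl mT (sx i) (sA_ i) (sI_ j)).
rewrite !(iprDr mT (sx j) (sA_ j)) //.
rewrite exx !ex // (iprC _ _ (A i s) (fun=> x j 0)) (iprC _ _ (I i s) (fun=> x j 0)).
rewrite !ex // (E1 (I i s)) (E1 (I j s)) !EI // (iprC _ _ (I i s) (A j s)) AA //.
(* Only algebra remains, so the moments are generalized to plain scalars. *)
clearbody I A f g.
move: (E2 (A i s) (fun=> 1)) (E2 (A j s) (fun=> 1)) (E2 (A i s) (I j s))
  (E2 (A j s) (I i s)) (E2 (I i s) (I j s)) (x i 0) (x j 0)
  (\int[leb]_(r in `[t, s]) E2 (f i r) (A j r))
  (\int[leb]_(r in `[t, s]) E2 (f j r) (A i r)) => *.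
ring.
Qed.

End LinearItoSystem.

Lemma Rintegral_sum (R : realType) d (T : measurableType d) (nu : {measure set T -> \bar R})
    (A : set T) (I : Type) (r : seq I) (h : I -> T -> R) :
  measurable A -> (forall i, nu.-integrable A (EFin \o h i)) ->
  nu.-integrable A (EFin \o (fun z => \sum_(i <- r) h i z)) /\
  \int[nu]_(z in A) (\sum_(i <- r) h i z) = \sum_(i <- r) \int[nu]_(z in A) h i z.
Proof.
move=> mA ih; elim: r => [|i r [IH1 IH2]].
  split; last first.
    by under eq_Rintegral do rewrite big_nil; rewrite big_nil Rintegral_cst // mul0r.
  by apply: eq_integrable (integrable0 nu A) => // z _; rewrite /= big_nil.
split.
  apply: eq_integrable (integrableDr mA (ih i) IH1) => // z _.
  by rewrite /= big_cons.
under eq_Rintegral do rewrite big_cons.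
by rewrite RintegralD // IH2 big_cons.
Qed.

Lemma Rintegral_bform (R : realType) d (Omega : measurableType d)
    (Pr : probability Omega R) n (M : 'M[R]_n) (u v : 'I_n -> Omega -> R) :
  (forall i, sqint Pr setT (u i)) -> (forall i, sqint Pr setT (v i)) ->
  Pr.-integrable setT
    (EFin \o (fun w => bform M (\col_i u i w) (\col_i v i w))) /\
  \int[Pr]_w bform M (\col_i u i w) (\col_i v i w) =
  \sum_i \sum_j M i j * ipr Pr setT (u i) (v j).
Proof.
move=> su sv; have mT := @measurableT _ Omega.
have suv i j := sqint_mul mT (su i) (sv j).
have isum i := Rintegral_sum (index_enum 'I_n) mT
  (fun j => integrableZr_fun mT (M i j) (suv i j)).
have [i1 e1] := Rintegral_sum (index_enum 'I_n) mT (fun i => (isum i).1).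
have bE w : bform M (\col_i u i w) (\col_i v i w) =
    \sum_i \sum_j M i j * (u i w * v j w).
  by rewrite bformE; do 2 (apply: eq_bigr => ? _); rewrite !mxE.
split; first by apply: eq_integrable i1 => // w _; rewrite /= bE.
under eq_Rintegral do rewrite bE; rewrite e1; apply: eq_bigr => i _.
by rewrite (isum i).2; apply: eq_bigr => j _; rewrite RintegralZl.
Qed.

(** * From a Lyapunov matrix to mean-square stability *)

Section MeanSquareStability.
Context d (Omega : measurableType d) (R : realType) (Pr : probability Omega R).
Variable W : R -> {RV Pr >-> R}.
Hypothesis hW : standard_brownian_motion W.
Notation leb := (@lebesgue_measure R).
Local Notation RR := (measurableTypeR R).
Local Notation mu := (prleb Pr).
Local Notation D a b := (@strip _ Omega R a b).
Local Notation E2 := (ipr Pr setT).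
Let mT := @measurableT _ Omega.

Variables (n : nat) (F G : 'M[R]_n) (P : 'M[R]_n).
Hypotheses (pP : posdefmx P) (pL : posdefmx (- lyap F G P)).

Section Solution.
Variables (x : 'cV[R]_n) (t : R) (X : R -> Omega -> 'cV[R]_n).
Hypothesis t0 : 0 <= t.
Hypothesis solX : sde_solution W F G t x X.

(** The solution is unconstrained before [t]; freezing it there gives measurable coordinates at all
    times and paths continuous on R. *)
Let Y j r w := X (Num.max t r) w j 0.

Let tmax r : t <= Num.max t r. Proof. by rewrite le_max lexx. Qed.

Let YX j r w : t <= r -> Y j r w = X r w j 0.
Proof. by move=> tr; rewrite /Y max_r. Qed.

Let pY j : cont_process (Y j).
Proof.
have [cX mX _ _] := solX; split=> [w|r].
  apply: (@continuous_maxl R t (fun r => X r w j 0)) => r.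
  apply: (@continuous_comp (subspace `[t, +oo[) _ _ (fun r => X r w)
    (fun M : 'cV[R]_n => M j 0)).
    exact: cX.
  exact: coord_continuous.
exact: measurable_wrt_measurable (mX _ (tmax r) j).
Qed.

Let sY_strip j s : t <= s -> sqint mu (D t s) (joint (Y j)).
Proof.
move=> ts; have [_ _ iX _] := solX.
have mj i := measurable_cont_process (pY i).
have msum : measurable_fun setT (fun z : Omega * RR => \sum_i joint (Y i) z ^+ 2).
  by apply: measurable_sum => i; apply: measurable_funX; exact: mj.
have mjj : measurable_fun setT (joint (Y j)) := mj j.
split; first exact: measurable_funTS.
apply/integrableP; split.
  by apply/measurable_EFinP; apply: measurable_funTS; exact: measurable_funX.
apply: le_lt_trans (iX s ts).
under eq_integral do rewrite /= ger0_norm ?sqr_ge0 //.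
apply: (@le_trans _ _ (\int[mu]_(z in D t s) (\sum_i joint (Y i) z ^+ 2)%:E)%E).
  apply: ge0_le_integral => //.
  - exact: measurable_strip.
  - by move=> z _; rewrite lee_fin sqr_ge0.
  - by apply/measurable_EFinP; apply: measurable_funTS; exact: measurable_funX.
  - by apply/measurable_EFinP; exact: measurable_funTS.
  - move=> z _; rewrite lee_fin (bigD1 j) //= lerDl sumr_ge0 // => i _.
    exact: sqr_ge0.
rewrite ge0_integral_strip //; last first.
  by move=> z; rewrite sumr_ge0 // => i _; exact: sqr_ge0.
rewrite le_eqVlt; apply/orP; left; apply/eqP.
apply: eq_integral => w _; apply: eq_integral => r /[!inE] /=.
rewrite in_itv /= => /andP[tr _]; congr EFin.
rewrite /sqr_norm mxE; apply: eq_bigr => i _.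
by rewrite /joint /= YX // mxE expr2.
Qed.

Let mulY (H : 'M[R]_n) i r w : t <= r ->
  \sum_l H i l * Y l r w = (H *m X r w) i 0.
Proof. by move=> tr; rewrite mxE; apply: eq_bigr => l _; rewrite YX. Qed.

Let ito i s : t <= s -> exists H : R -> Omega -> R,
  (forall r w, t <= r <= s -> H r w = \sum_l G i l * Y l r w) /\
  is_ito_integral W H t s (fun w => Y i s w - x i 0 -
     \int[leb]_(r in `[t, s]) \sum_l F i l * Y l r w).
Proof.
move=> ts; have [_ _ _ itoX] := solX.
exists (fun r w => (G *m X r w) i 0); split.
  by move=> r w /andP[tr _]; rewrite mulY.
rewrite (_ : (fun w => _) = (fun w => X s w i 0 - x i 0 -
   \int[leb]_(r in `[t, s]) (F *m X r w) i 0)); first exact: itoX.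
apply/funext => w; rewrite YX //; congr (_ - _).
apply: eq_Rintegral => r; rewrite inE /= in_itv /= => /andP[tr _].
by rewrite mulY.
Qed.

Let y r w : 'cV[R]_n := \col_i Y i r w.
Let V s := \int[Pr]_w bform P (y s w) (y s w).
Let L s := \int[Pr]_w bform (lyap F G P) (y s w) (y s w).

Let sY i s : t <= s -> sqint Pr setT (Y i s).
Proof. by move=> ts; exact: (sqint_solution hW t0 pY sY_strip ito i ts). Qed.

Let f i r w := \sum_l F i l * Y l r w.
Let g i r w := \sum_l G i l * Y l r w.

Let integrable_y M s : t <= s ->
  Pr.-integrable setT (EFin \o (fun w => bform M (y s w) (y s w))).
Proof.
by move=> ts; have [] := Rintegral_bform M (fun i => sY i ts) (fun i => sY i ts).
Qed.

Let sum_mat M (e : 'I_n -> 'I_n -> R -> R) s :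
  (forall i j, leb.-integrable `[t, s] (EFin \o e i j)) ->
  leb.-integrable `[t, s] (EFin \o (fun r => \sum_i \sum_j M i j * e i j r)) /\
  \int[leb]_(r in `[t, s]) (\sum_i \sum_j M i j * e i j r) =
  \sum_i \sum_j M i j * \int[leb]_(r in `[t, s]) e i j r.
Proof.
move=> ie; have mts : @measurable _ RR `[t, s] by exact: measurable_itv.
have isum i := Rintegral_sum (index_enum 'I_n) mts
  (fun j => integrableZr_fun mts (M i j) (ie i j)).
have [i1 e1] := Rintegral_sum (index_enum 'I_n) mts (fun i => (isum i).1).
split; first exact: i1.
rewrite e1; apply: eq_bigr => i _; rewrite (isum i).2; apply: eq_bigr => j _.
by rewrite RintegralZl.
Qed.

Let VE s : t <= s -> V s = \sum_i \sum_j P i j * E2 (Y i s) (Y j s).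
Proof.
by move=> ts; exact: (Rintegral_bform P (fun i => sY i ts) (fun i => sY i ts)).2.
Qed.

Let dV i j r := E2 (f i r) (Y j r) + E2 (f j r) (Y i r) + E2 (g i r) (g j r).

(** The three summands of [bform_lyap] become the two drift moments and the diffusion moment of the
    entrywise identity [second_moment]. *)
Let LE r : t <= r -> L r = \sum_i \sum_j P i j * dV i j r.
Proof.
move=> tr; have sYr i := sY i tr.
have sl (H : 'M[R]_n) i : sqint Pr setT (fun w => \sum_l H i l * Y l r w).
  by apply: sqint_sum => // l _; exact: sqintZ.
have sf i : sqint Pr setT (f i r) := sl F i.
have sg i : sqint Pr setT (g i r) := sl G i.
have [i1 e1] := Rintegral_bform P sYr sf.
have [i2 e2] := Rintegral_bform P sf sYr.
have [i3 e3] := Rintegral_bform P sg sg.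
have mulE (H : 'M[R]_n) w : H *m y r w = \col_i \sum_l H i l * Y l r w.
  apply/colP => i; rewrite !mxE; apply: eq_bigr => l _; by rewrite mxE.
have LrE w : bform (lyap F G P) (y r w) (y r w) =
    bform P (\col_i Y i r w) (\col_i f i r w) +
    bform P (\col_i f i r w) (\col_i Y i r w) +
    bform P (\col_i g i r w) (\col_i g i r w).
  by rewrite bform_lyap !mulE.
rewrite /L; under eq_Rintegral do rewrite LrE.
rewrite RintegralD //; last exact: integrableDr.
rewrite RintegralD // e1 e2 e3 -!big_split /=; apply: eq_bigr => i _.
rewrite -!big_split /=; apply: eq_bigr => j _.
by rewrite (iprC _ _ (Y i r)) -!mulrDr [X in _ * (X + _)]addrC.
Qed.

Let V_integrable s : t <= s -> leb.-integrable `[t, s] (EFin \o V).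
Proof.
move=> ts.
have ie i j := second_moment_integrable hW t0 pY sY_strip ito i j ts.
apply: eq_integrable (sum_mat P ie).1 => [|r]; first exact: measurable_itv.
by rewrite inE /= in_itv /= => /andP[tr _]; rewrite VE.
Qed.

Let dV_integrable i j s : t <= s -> leb.-integrable `[t, s] (EFin \o dV i j).
Proof.
move=> ts; have mts : @measurable _ RR `[t, s] by exact: measurable_itv.
have i1 := drift_moment_integrable hW t0 pY sY_strip ito i j ts.
have i2 := drift_moment_integrable hW t0 pY sY_strip ito j i ts.
have i3 := diffusion_moment_integrable hW t0 pY sY_strip ito i j ts.
exact: (integrableDr mts (integrableDr mts i1 i2) i3).
Qed.

Let L_integrable s : t <= s -> leb.-integrable `[t, s] (EFin \o L).
Proof.
move=> ts.
apply: eq_integrable (sum_mat P (fun i j => dV_integrable i j ts)).1 => [|r].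
  exact: measurable_itv.
by rewrite inE /= in_itv /= => /andP[tr _]; rewrite LE.
Qed.

Let V_eq s : t <= s -> V s = bform P x x + \int[leb]_(r in `[t, s]) L r.
Proof.
move=> ts; rewrite VE // bformE.
have -> : \int[leb]_(r in `[t, s]) L r =
    \int[leb]_(r in `[t, s]) (\sum_i \sum_j P i j * dV i j r).
  by apply: eq_Rintegral => r; rewrite inE /= in_itv /= => /andP[tr _]; rewrite LE.
rewrite (sum_mat P (fun i j => dV_integrable i j ts)).2 -big_split /=.
apply: eq_bigr => i _; rewrite -big_split /=; apply: eq_bigr => j _.
rewrite -mulrDr; congr (_ * _).
exact: (second_moment hW t0 pY sY_strip ito i j ts).
Qed.

Let V_ge0 s : 0 <= V s.
Proof. by apply: Rintegral_ge0 => w _; exact: posdefmx_ge0. Qed.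

Let L_le (c : R) s : t <= s ->
  (forall v, c * bform P v v <= bform (- lyap F G P) v v) -> L s <= - c * V s.
Proof.
move=> ts cP; rewrite /L /V -RintegralZl //; last exact: integrable_y.
apply: le_Rintegral => //; first exact: integrable_y.
  exact: (integrableZr_fun mT (- c) (integrable_y P ts)).
by move=> w _; have := cP (y s w); rewrite bformNm mulNr lerNr.
Qed.

Let V_noninc r s : t <= r -> r <= s -> V s <= V r.
Proof.
move=> tr rs; have ts := le_trans tr rs; rewrite !V_eq // lerD2l -subr_le0.
rewrite Rintegral_itvB ?bnd_simp //; last exact: L_integrable.
rewrite -oppr_ge0 -mulN1r -RintegralZl //; last first.
  apply: integrableS (L_integrable ts) => //.
  by apply: subset_itvr; rewrite bnd_simp.
apply: Rintegral_ge0 => u /=; rewrite in_itv /= => /andP[ru _].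
rewrite mulN1r oppr_ge0.
(* Only the sign matters here: coercivity gives L(u) <= - c V(u) <= 0. *)
have [c c0 cP] := posdefmx_coercive pL pP.
have tu : t <= u by exact: le_trans tr (ltW ru).
by apply: le_trans (L_le tu cP) _; rewrite mulNr oppr_le0 mulr_ge0 // ltW.
Qed.

Lemma second_moment_decay : exists k : R, forall s, t < s ->
  0 <= (s - t) * \int[Pr]_w ((X s w)^T *m X s w) 0 0 <= k.
Proof.
have [c c0 cP] := posdefmx_coercive pL pP.
have [a a0 aP] := posdefmx_coercive pP posdef1.
(* Here [c] compares - L(P) with P and [a] compares P with the identity: a (s - t) E|X(s)|^2 <= (s -
   t) V(s) <= \int V <= x^T P x / c. *)
exists ((a * c)^-1 * bform P x x) => s ts; have ts' := ltW ts.
have mts : @measurable _ RR `[t, s] by exact: measurable_itv.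
have Xy w : X s w = y s w by apply/colP => j; rewrite mxE YX.
under eq_Rintegral do rewrite Xy -bform1.
have aV : a * \int[Pr]_w bform 1%:M (y s w) (y s w) <= V s.
  rewrite -RintegralZl //; last exact: integrable_y.
  apply: le_Rintegral => //; last exact: integrable_y.
  exact: (integrableZr_fun mT a (integrable_y _ ts')).
have cst_eq : \int[leb]_(r in `[t, s]) V s = (s - t) * V s.
  rewrite (Rintegral_cst _ mts) mulrC.
  exact: (congr1 (fun u => u * V s) (fine_leb_itv ts')).
have cst_int : leb.-integrable `[t, s] (EFin \o (fun=> V s)).
  by apply: continuous_itv_integrable; exact: cst_continuous.
have le_int : (s - t) * V s <= \int[leb]_(r in `[t, s]) V r.
  rewrite -cst_eq; apply: le_Rintegral => //; first exact: V_integrable.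
  by move=> r /=; rewrite in_itv /= => /andP[tr rs]; exact: V_noninc.
have int_le : c * \int[leb]_(r in `[t, s]) V r <= bform P x x.
  rewrite -RintegralZl //; last exact: V_integrable.
  (* Read from 0 <= V(s) = x^T P x + \int L <= x^T P x - c \int V. *)
  rewrite -subr_ge0; apply: le_trans (V_ge0 s) _.
  rewrite V_eq // lerD2l -mulN1r -RintegralZl //; last first.
    exact: (integrableZr_fun mts c (V_integrable ts')).
  apply: le_Rintegral => //; first exact: L_integrable.
    by do 2 apply: integrableZr_fun => //; exact: V_integrable.
  by move=> r /=; rewrite in_itv /= => /andP[tr _]; rewrite mulN1r -mulNr L_le.
apply/andP; split.
  rewrite mulr_ge0 ?subr_ge0 //; apply: Rintegral_ge0 => w _.
  exact: posdefmx_ge0 posdef1.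
rewrite ler_pdivlMl ?mulr_gt0 //; apply: le_trans int_le.
set q := Rintegral _ _ _ in aV *.
rewrite [leLHS](_ : _ = c * ((s - t) * (a * q))); last by ring.
apply: ler_wpM2l; first exact: ltW.
by apply: le_trans le_int; apply: ler_wpM2l => //; rewrite subr_ge0.
Qed.

Lemma mean_square_stable :
  'E_Pr[fun w => (((X s w)^T *m X s w) 0 0)%R]%E @[s --> +oo] --> 0%E.
Proof.
have [k decay] := second_moment_decay.
pose q s := \int[Pr]_w ((X s w)^T *m X s w) 0 0.
have q0 : q s @[s --> +oo] --> (0 : R).
  apply/cvgrPdist_le => e e0; near=> s.
  have ts : t < s by near: s; exact: nbhs_pinfty_gt (num_real _).
  have /andP[q_ge0 q_le] := decay s ts.
  have st0 : 0 < s - t by rewrite subr_gt0.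
  rewrite sub0r normrN ger0_norm; last by rewrite -(pmulr_rge0 _ st0).
  rewrite -(ler_pM2l st0); apply: le_trans q_le _.
  rewrite -ler_pdivrMr // lerBrDr; near: s.
  exact: nbhs_pinfty_ge (num_real _).
(* The claim concerns the extended expectation, which is finite and equal to [q s] once s >= t. *)
suff : (q s)%:E @[s --> +oo] --> 0%E.
  apply: cvg_trans; apply: near_eq_cvg; near=> s.
  have ts : t <= s by near: s; exact: nbhs_pinfty_ge (num_real _).
  rewrite unlock /q /Rintegral fineK //.
  apply: integrable_fin_num => //.
  apply: eq_integrable (integrable_y 1%:M ts) => // w _ /=.
  by rewrite bform1; congr ((_^T *m _) 0 0)%:E; apply/colP => j; rewrite mxE YX.
by apply/fine_cvgP; split; [near=> s | exact: q0].
Unshelve. all: by end_near.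
Qed.

End Solution.
End MeanSquareStability.

Theorem theorem3p3 (R : realType) (d : measure_display)
    (Omega : measurableType d) (Pr : probability Omega R)
    (W : R -> {RV Pr >-> R}) (hW : standard_brownian_motion W)
    (n m : nat) (A C : 'M[R]_n) (B D : 'M[R]_(n, m))
    (stabilizable : exists K : 'M[R]_(m, n), stabilizer W A B C D K)
    (QT : 'M[R]_n) (RT : 'M[R]_m) (hQT : posdefmx QT) (hRT : posdefmx RT)
    (PT : 'M[R]_n) (hPT : posdefmx PT)
    (PT_sol : riccati_eq A B C D QT RT PT)
    (PT_unique : forall P' : 'M[R]_n,
       posdefmx P' -> riccati_eq A B C D QT RT P' -> P' = PT)
    (KT : 'M[R]_(m, n)) (hKT : KT = gain B C D RT PT)
    (KT_stab : stabilizer W A B C D KT)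
    (S : 'M[R]_m) (Q0 : 'M[R]_n) (hS : posdefmx S) (hQ0 : posdefmx Q0)
    (P : nat -> 'M[R]_n) (K : nat -> 'M[R]_(m, n)) (Q : nat -> 'M[R]_n)
    (iter : irl_iteration A B C D KT S Q0 P K Q) :
  forall i : nat,
    stabilizer W A B C D (K i.+1).
Proof.
(* The expert's Riccati solution is the comparison matrix that makes every [P i] positive
   definite. *)
have pL : posdefmx (- closed_lyap A C B D KT PT).
  by rewrite hKT; exact: riccati_lyap hQT hRT hPT PT_sol.
move=> i t x X t0 solX.
have [pP pLi] := irl_lyap hPT pL hS hQ0 iter i.
exact: (mean_square_stable hW pP pLi t0 solX).
Qed.
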